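(* Let $$U_0(x)=\sqrt{\sqrt{1/15}+|x|^2},\qquad \Lambda^*:=\int_{\mathbb{R}^3}\frac{dx}{U_0^6(x)}=\int_{\mathbb{R}^3}\frac{dx}{\left(\sqrt{1/15}+|x|^2\right)^3}.$$ For a positive radial solution $u$ of $$\Delta^2 u=-\frac{1}{u^7}\quad\text{in }\mathbb{R}^3,\qquad u>0,$$ set $\Lambda_u:=\int_{\mathbb{R}^3}u^{-6}(x)\,dx$. Then a value $\Lambda$ is attained as $\Lambda_u$ by some positive radial solution $u$ of this equation if and only if $\Lambda\in(0,\Lambda^*]$. Moreover, if $u$ is a positive radial solution with $\Lambda_u=\Lambda^*$, then $u$ coincides with $U_0$ up to a scaling, i.e. there is $\lambda>0$ with $u(x)=\lambda^{-1/2}U_0(\lambda x)$ for all $x\in\mathbb{R}^3$.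
   Context: Solutions are understood as smooth (in particular $C^4$) functions on all of $\mathbb{R}^3$. The scaling $u\mapsto \lambda^{-1/2}u(\lambda x)$, $\lambda>0$, maps solutions to solutions and preserves $\Lambda_u$. $U_0$ is itself a positive radial solution of the equation. *)

(* Defs.v *)
From HB Require Import structures.
From mathcomp Require Import all_boot all_order all_algebra.
From mathcomp Require Import all_classical all_reals all_analysis.
Set Implicit Arguments. Unset Strict Implicit. Unset Printing Implicit Defensive.
Import Order.TTheory GRing.Theory Num.Theory.
Import numFieldNormedType.Exports.
Local Open Scope classical_set_scope.
Local Open Scope ring_scope.

(* Points of R^3 are represented as ((x1, x2), x3) : (R * R) * R, so that the
   Lebesgue measure on R^3 is the product of three copies of the Lebesgue
   measure on R. *)
Notation R3 R := ((R * R) * R)%type.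

Section Defs.
Variable R : realType.

Definition coord (i : 'I_3) (p : R3 R) : R :=
  match val i with 0%N => p.1.1 | 1%N => p.1.2 | _ => p.2 end.

Definition upd (i : 'I_3) (p : R3 R) (t : R) : R3 R :=
  match val i with
  | 0%N => ((t, p.1.2), p.2)
  | 1%N => ((p.1.1, t), p.2)
  | _ => ((p.1.1, p.1.2), t)
  end.

Definition line (i : 'I_3) (f : R3 R -> R) (p : R3 R) : R -> R :=
  fun t => f (upd i p t).

Definition partial (i : 'I_3) (f : R3 R -> R) : R3 R -> R :=
  fun p => derive1 (line i f p) (coord i p).

Fixpoint Ck (k : nat) (f : R3 R -> R) : Prop :=
  match k with
  | 0%N => continuous f
  | k.+1 => continuous f /\
      forall i : 'I_3, (forall p, derivable (line i f p) (coord i p) 1) /\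
                       Ck k (partial i f)
  end.

Definition smooth (f : R3 R -> R) : Prop := forall k, Ck k f.

Definition laplacian (f : R3 R -> R) : R3 R -> R :=
  fun p => \sum_(i < 3) partial i (partial i f) p.

Definition bilaplacian (f : R3 R -> R) : R3 R -> R := laplacian (laplacian f).

Definition enorm (p : R3 R) : R :=
  Num.sqrt (p.1.1 ^+ 2 + p.1.2 ^+ 2 + p.2 ^+ 2).

Definition scale3 (l : R) (p : R3 R) : R3 R :=
  ((l * p.1.1, l * p.1.2), l * p.2).

Definition radial (u : R3 R -> R) : Prop :=
  forall p q : R3 R, enorm p = enorm q -> u p = u q.

Definition pos_radial_solution (u : R3 R -> R) : Prop :=
  smooth u /\ radial u /\ (forall p, 0 < u p) /\
  (forall p, bilaplacian u p = - (u p ^+ 7)^-1).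

Definition leb3 :=
  (((@lebesgue_measure R) \x (@lebesgue_measure R)) \x (@lebesgue_measure R))%E.

Definition Lambda (u : R3 R -> R) : \bar R :=
  (\int[leb3]_(p in setT) ((u p ^+ 6)^-1)%:E)%E.

Definition U0 (p : R3 R) : R :=
  Num.sqrt (Num.sqrt (15%:R^-1) + enorm p ^+ 2).

Definition Lambda_star : \bar R := Lambda U0.

End Defs.

(* Main.v *)
(* A radial solution is determined by its value and its Laplacian at the origin:
   its profile [g] and the profile [h] of its Laplacian solve [Delta g = h],
   [Delta h = - g^-7] on the half line. After scaling, compare [g] with the
   explicit solution U_0 having the same value at the origin. A larger Laplacian
   at the origin gives a larger function, with a gap growing like r^2. If [h 0]
   is smaller than for U_0, the linear growth of U_0 forces [g] to become
   negative; if it is equal, [g] is U_0; if it is larger, [g] exceeds U_0 and its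
   Lambda is strictly smaller. Conversely, every larger value of [h 0] is realised
   by a monotone fixed-point argument above U_0, and Lambda depends continuously
   on it and tends to 0, so that all intermediate values are attained. *)
Require Import Defs.
From HB Require Import structures.
From mathcomp Require Import all_boot all_order all_algebra.
From mathcomp Require Import all_classical all_reals all_analysis.
From mathcomp Require Import measurable_realfun ring lra.
Set Implicit Arguments. Unset Strict Implicit. Unset Printing Implicit Defensive.
Import Order.TTheory GRing.Theory Num.Theory.
Import numFieldNormedType.Exports.
Local Open Scope ring_scope.

(** * Derivatives of real functions *)

Section RealAnalysis.
Variable R : realType.
Implicit Types (f g w : R -> R) (x y r s t a b c d e : R).

(** The radial Laplacian is singular at the origin, so [g] is paired with [p = g' / r] rather than
    with g'. Then g' = r p and (r^3 p)' = r^2 h, and every differential inequality is integrated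
    from 0 by monotonicity. Comparison and the fixed point both rest on the fact that - g^-7
    increases with g: the system for (g, h) is cooperative, and an ordering of the data at the
    origin propagates outwards. The obstacle is that g might approach 0. Existence is therefore
    sought only above U_0, whose minimum bounds g from below and keeps g^-7 bounded and Lipschitz.
    Uniqueness and continuous dependence do not follow from monotonicity. They come from the
    substitution y = r g, under which the radial bilaplacian becomes a plain fourth derivative, so
    that a Gronwall estimate works up to the origin. *)

Lemma drvC c x : is_derive x 1 (fun _ : R => c) 0.
Proof. exact: is_derive_cst. Qed.

Lemma drvI x : is_derive x 1 (fun t : R => t) 1.
Proof. exact: is_derive_id. Qed.

Lemma drvD f g x a b : is_derive x 1 f a -> is_derive x 1 g b ->
  is_derive x 1 (fun t => f t + g t) (a + b).
Proof. exact: is_deriveD. Qed.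

Lemma drvN f x a : is_derive x 1 f a -> is_derive x 1 (fun t => - f t) (- a).
Proof. exact: is_deriveN. Qed.

Lemma drvM f g x a b : is_derive x 1 f a -> is_derive x 1 g b ->
  is_derive x 1 (fun t => f t * g t) (f x * b + g x * a).
Proof. exact: is_deriveM. Qed.

Lemma drvX f n x a : is_derive x 1 f a ->
  is_derive x 1 (fun t => f t ^+ n) (n%:R * f x ^+ n.-1 * a).
Proof.
move=> h; rewrite [X in is_derive _ _ X](_ : _ = f ^+ n); first exact: is_deriveX.
by apply/funext => t; rewrite fctE.
Qed.

Lemma drvV f x a : f x != 0 -> is_derive x 1 f a ->
  is_derive x 1 (fun t => (f t)^-1) (- (f x ^- 2) * a).
Proof. by move=> f0 h; exact: is_deriveV. Qed.

Lemma drvE f x a b : is_derive x 1 f a -> a = b -> is_derive x 1 f b.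
Proof. by move=> h <-. Qed.

Lemma drv_comp f g x a b : is_derive (g x) 1 f a -> is_derive x 1 g b ->
  is_derive x 1 (fun t => f (g t)) (a * b).
Proof. by move=> hf hg; exact: is_derive1_comp. Qed.

Lemma drv_continuous f x a : is_derive x 1 f a -> {for x, continuous f}.
Proof. by move=> [h _]; apply/differentiable_continuous/derivable1_diffP. Qed.

Lemma drv_eq_pos f g r a : 0 < r -> (forall s, 0 < s -> f s = g s) ->
  is_derive r 1 f a -> is_derive r 1 g a.
Proof.
move=> r0 fg; apply: near_eq_is_derive.
by near=> s; apply: fg; near: s; exact: lt_nbhsr.
Unshelve. all: by end_near. Qed.

End RealAnalysis.

(** Differentiation by the syntax of the body, with the derivative left to be inferred. [drve] then
    leaves the equation between the computed and the expected derivative, usually for [ring] or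
    [field]. *)
Ltac drv := lazymatch goal with
  | |- is_derive _ _ (fun _ => ?c) _ => exact (drvC c _)
  | |- is_derive _ _ (fun t => t) _ => exact (drvI _)
  | |- is_derive _ _ (fun t => - @?f t) _ => notypeclasses refine (@drvN _ f _ _ _); drv
  | |- is_derive _ _ (fun t => @?f t + @?g t) _ =>
      notypeclasses refine (@drvD _ f g _ _ _ _ _); [drv|drv]
  | |- is_derive _ _ (fun t => @?f t * @?g t) _ =>
      notypeclasses refine (@drvM _ f g _ _ _ _ _); [drv|drv]
  | |- is_derive _ _ (fun t => (@?f t)^-1) _ =>
      notypeclasses refine (@drvV _ f _ _ _ _); [|drv]
  | |- is_derive _ _ (fun t => (@?f t) ^+ ?n) _ =>
      notypeclasses refine (@drvX _ f n _ _ _); drv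
  | |- _ => try eassumption
  end.

Ltac drve := notypeclasses refine (@drvE _ _ _ _ _ _ _); [drv|rewrite ?/=].

(** * Continuity and monotonicity on the closed half line *)

Section Radial.
Variable R : realType.
Implicit Types (f g w : R -> R) (x y r s t a b c d e : R).

(* Radial profiles live on [0, +oo[: their values at negative arguments are
   irrelevant, hence the composition with the absolute value. *)
Definition cont0 f : Prop := continuous (fun r => f `|r|).

Lemma cont0_mono f df a b : cont0 f -> 0 <= a -> a <= b ->
  (forall r, a < r < b -> is_derive r 1 f (df r)) ->
  (forall r, a < r < b -> 0 <= df r) -> f a <= f b.
Proof.
move=> cf a0 ab dfE df0.
(* The conditional covers the degenerate case [a = b], in which there is no interior point at which
   to evaluate [df]. *)
have [c cab E] : exists2 c, c \in `[a, b] &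
    f `|b| - f `|a| = (if (a < c < b) then df c else 0) * (b - a).
  move: ab; rewrite le_eqVlt => /orP[/eqP <-|ab].
    by exists a; rewrite ?subrr ?mulr0// in_itv/= lexx.
  have [|| c cab E] := @MVT _ (fun r => f `|r|) df a b ab.
  - move=> x; rewrite in_itv/= => xab; apply: (@drv_eq_pos _ f).
    + by apply: le_lt_trans a0 _; case/andP: xab.
    + by move=> s s0; rewrite gtr0_norm.
    + exact: dfE.
  - exact: continuous_subspaceT.
  - exists c; first exact: subset_itv_oo_cc cab.
    by move: cab; rewrite in_itv/= => ->.
rewrite ger0_norm in E; last exact: le_trans ab.
rewrite ger0_norm// in E.
rewrite -subr_ge0 E mulr_ge0 ?subr_ge0//.
by case: ifP => // /df0.
Qed.

Lemma cont0D f g : cont0 f -> cont0 g -> cont0 (fun r => f r + g r).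
Proof. by move=> cf cg r; apply: cvgD; [exact: cf|exact: cg]. Qed.

Lemma cont0N f : cont0 f -> cont0 (fun r => - f r).
Proof. by move=> cf r; apply: cvgN; exact: cf. Qed.

Lemma cont0M f g : cont0 f -> cont0 g -> cont0 (fun r => f r * g r).
Proof. by move=> cf cg r; apply: cvgM; [exact: cf|exact: cg]. Qed.

Lemma cont0C c : cont0 (fun=> c).
Proof. by move=> r; exact: cvg_cst. Qed.

Lemma cont0I : cont0 (fun r => r).
Proof. by move=> r; exact: norm_continuous. Qed.

Lemma cont0X f n : cont0 f -> cont0 (fun r => f r ^+ n).
Proof.
move=> cf; elim: n => [|n IH]; first exact: cont0C.
rewrite (_ : (fun r => _) = fun r => f r * f r ^+ n); first exact: cont0M.
by apply/funext => r; rewrite exprS.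
Qed.

Lemma cont0V f : (forall r, 0 <= r -> f r != 0) -> cont0 f ->
  cont0 (fun r => (f r)^-1).
Proof. by move=> f0 cf r; apply: cvgV; [exact: f0|exact: cf]. Qed.

End Radial.
Ltac cont := lazymatch goal with
  | |- cont0 (fun _ => ?c) => refine (@cont0C _ c)
  | |- cont0 (fun t => t) => refine (@cont0I _)
  | |- cont0 (fun t => - @?f t) => refine (@cont0N _ f _); cont
  | |- cont0 (fun t => @?f t + @?g t) => refine (@cont0D _ f g _ _); [cont|cont]
  | |- cont0 (fun t => @?f t * @?g t) => refine (@cont0M _ f g _ _); [cont|cont]
  | |- cont0 (fun t => (@?f t)^-1) => refine (@cont0V _ f _ _); [|cont]
  | |- cont0 (fun t => (@?f t) ^+ ?n) => refine (@cont0X _ f n _); cont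
  | |- _ => try eassumption
  end.

(** * The radial Laplacian and the comparison principle *)

Section RadialLaplacian.
Variable R : realType.
Implicit Types (f g w p h k q F P : R -> R) (r s t a b c d e : R).

Lemma cont0_near0 f e : cont0 f -> 0 < e ->
  exists2 d, 0 < d & forall r, 0 <= r < d -> `|f r - f 0| <= e.
Proof.
move=> /(_ 0) /cvgrPdist_le cf e0; have [d /= d0 dP] := cf _ e0.
exists d => // r /andP[r0 rd]; have := dP r; rewrite /= sub0r normrN (ger0_norm r0).
by move=> /(_ rd); rewrite normr0 distrC.
Qed.

(** A quantitative l'Hopital rule at 0. For either sign [sg], the function e r^(n+1) / (n+1) - sg (P
    - F(0) r^(n+1) / (n+1)) vanishes at 0 and has derivative r^n (e - sg (F - F(0))) >= 0. *)
Lemma ratio_bound n P F b e : cont0 P -> cont0 F -> P 0 = 0 ->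
  (forall r, 0 < r -> is_derive r 1 P (r ^+ n * F r)) ->
  (forall r, 0 < r < b -> `|F r - F 0| <= e) ->
  forall r, 0 < r < b -> `|P r / r ^+ n.+1 - F 0 / n.+1%:R| <= e / n.+1%:R.
Proof.
move=> cP cF P0 dP Fe r /andP[r0 rb].
have N0 : 0 < n.+1%:R :> R by rewrite ltr0n.
have mono sg : `|sg| = 1 ->
    sg * (P r - F 0 * r ^+ n.+1 / n.+1%:R) <= e * r ^+ n.+1 / n.+1%:R.
  move=> sg1; pose f s := e * s ^+ n.+1 * n.+1%:R^-1
    - sg * (P s - F 0 * s ^+ n.+1 * n.+1%:R^-1).
  pose df s := s ^+ n * (e - sg * (F s - F 0)).
  have : f 0 <= f r.
    apply: (@cont0_mono _ f df 0 r); rewrite ?(ltW r0)//; first by rewrite /f; cont.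
    - move=> s /andP[s0 sr]; have h := dP s s0.
      rewrite /f; drve.
      by rewrite /df/=; field; rewrite gt_eqF.
    - move=> s /andP[s0 sr]; rewrite /df mulr_ge0 ?exprn_ge0 ?(ltW s0)//.
      rewrite subr_ge0 (le_trans (ler_norm _))// normrM sg1 mul1r.
      by apply: Fe; rewrite s0 (lt_trans sr).
  by rewrite /f P0 exprS mul0r !mulr0 !mul0r !subrr mulr0 subrr subr_ge0.
have rn0 : 0 < r ^+ n.+1 by rewrite exprn_gt0.
have -> : P r / r ^+ n.+1 - F 0 / n.+1%:R =
    (P r - F 0 * r ^+ n.+1 / n.+1%:R) / r ^+ n.+1.
  by field; rewrite !gt_eqF.
rewrite normrM normfV (gtr0_norm rn0) ler_pdivrMr//.
rewrite (mulrAC e) ler_norml.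
have h1 := mono 1 (normr1 _); have h2 := mono (-1) (normrN1 _).
rewrite mul1r in h1; rewrite mulN1r in h2.
by rewrite h1 andbT lerNl.
Qed.

Lemma cont0_ext f c : (forall r, 0 < r -> {for r, continuous f}) ->
  (forall e, 0 < e -> exists2 d, 0 < d & forall r, 0 < r < d -> `|f r - c| <= e) ->
  cont0 (fun r => if 0 < r then f r else c).
Proof.
move=> cf fc x; have [->|x0] := eqVneq x 0.
  apply/cvgrPdist_le => e e0; have [d d0 dP] := fc e e0.
  exists d => //= r /=; rewrite sub0r normrN => rd.
  rewrite normr0 ltxx; case: ifPn => [r0|_]; last by rewrite subrr normr0 ltW.
  by rewrite distrC dP// r0.
have nx : 0 < `|x| by rewrite normr_gt0.
have : {for x, continuous (fun r => f `|r|)}.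
  by apply: continuous_comp; [exact: norm_continuous|exact: cf].
rewrite /continuous_at nx; apply: cvg_trans; apply: near_eq_cvg.
near=> s; have -> // : 0 < `|s|.
near: s; have := @norm_continuous R R x; rewrite /continuous_at.
by move=> /(_ [set t | 0 < t]%classic); apply; exact: lt_nbhsr.
Unshelve. all: by end_near. Qed.

(** Fills the removable singularity of P / r^(n+1) with its limit. Every quotient by a power of r
    below is made continuous at 0 in this way. *)
Lemma ratio_cont0 n P F : cont0 P -> cont0 F -> P 0 = 0 ->
  (forall r, 0 < r -> is_derive r 1 P (r ^+ n * F r)) ->
  cont0 (fun r => if 0 < r then P r / r ^+ n.+1 else F 0 / n.+1%:R).
Proof.
move=> cP cF P0 dP; apply: cont0_ext => [r r0|e e0].
  apply: cvgM; first exact: (drv_continuous (dP r r0)).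
  apply: cvgV; first by rewrite gt_eqF// exprn_gt0.
  exact: exprn_continuous.
have [d d0 dF] := cont0_near0 cF e0.
exists d => // r rd; apply: le_trans (ratio_bound cP cF P0 dP _ rd) _.
  by move=> s /andP[s0 sd]; apply: dF; rewrite ltW.
by rewrite ler_pdivrMr ?ltr0n// ler_peMr ?ler1n// ltW.
Qed.

(* [h = g'' + 2 g' / r] is the Laplacian of the radial function with profile
   [g] on R^3; the second argument is [g' / r], which stays continuous at 0. *)
Definition rlap g p h : Prop := [/\ cont0 g, cont0 p, cont0 h,
  forall r, 0 < r -> is_derive r 1 g (r * p r) &
  forall r, 0 < r -> is_derive r 1 p ((h r - 3 * p r) / r)].

Lemma rlapN g p h : rlap g p h ->
  rlap (fun r => - g r) (fun r => - p r) (fun r => - h r).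
Proof.
move=> [cg cp ch dg dp]; split; try cont; move=> r r0.
- have e := dg r r0; drve.
  by rewrite mulrN.
- have e := dp r r0; drve.
  by field; rewrite gt_eqF.
Qed.

Lemma rlapD g1 p1 h1 g2 p2 h2 : rlap g1 p1 h1 -> rlap g2 p2 h2 ->
  rlap (fun r => g1 r + g2 r) (fun r => p1 r + p2 r) (fun r => h1 r + h2 r).
Proof.
move=> [cg1 cp1 ch1 dg1 dp1] [cg2 cp2 ch2 dg2 dp2]; split; try cont; move=> r r0.
- have e1 := dg1 r r0; have e2 := dg2 r r0; drve.
  by rewrite mulrDr.
- have e1 := dp1 r r0; have e2 := dp2 r r0; drve.
  by field; rewrite gt_eqF.
Qed.

(** Integrate twice from 0: (r^3 p)' = r^2 k gives p >= d / 3, and w' = r p gives the rest. The 6 is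
    the Laplacian of r^2 in dimension 3. *)
Lemma rlap_lower w p k b d : rlap w p k ->
  (forall r, 0 < r < b -> d <= k r) ->
  forall r, 0 <= r <= b ->
    w 0 + d * r ^+ 2 / 6 <= w r /\ (0 < r -> d / 3 <= p r).
Proof.
move=> [cw cp ck dw dp] kd.
have pd s : 0 < s <= b -> d / 3 <= p s.
  move=> /andP[s0 sb]; pose f t := t ^+ 3 * p t - d * t ^+ 3 * 3^-1.
  have : f 0 <= f s.
    apply: (@cont0_mono R f (fun t => t ^+ 2 * (k t - d))); rewrite ?(ltW s0)//.
    - by rewrite /f; cont.
    - move=> t /andP[t0 ts]; have h := dp t t0.
      rewrite /f; drve.
      by rewrite /=; field; rewrite gt_eqF.
    - move=> t /andP[t0 ts]; rewrite mulr_ge0 ?sqr_ge0// subr_ge0 kd//.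
      by rewrite t0 (lt_le_trans ts).
  rewrite /f !expr0n/= mul0r mulr0 mul0r subr0 subr_ge0 mulrAC mulrC.
  by rewrite ler_pM2l// exprn_gt0.
move=> r /andP[r0 rb]; split; last by move=> r1; rewrite pd// r1.
pose f t := w t - d * t ^+ 2 * 6^-1.
have : f 0 <= f r.
  apply: (@cont0_mono R f (fun t => t * (p t - d / 3))) => //.
  - by rewrite /f; cont.
  - move=> t /andP[t0 tr]; have h := dw t t0.
    rewrite /f; drve.
    by rewrite /=; field.
  - move=> t /andP[t0 tr]; rewrite mulr_ge0 ?(ltW t0)// subr_ge0 pd//.
    by rewrite t0 (le_trans (ltW tr)).
by rewrite /f expr0n/= mulr0 mul0r subr0 lerBrDr.
Qed.

Lemma first_zero k r : cont0 k -> 0 < k 0 -> 0 <= r -> k r <= 0 ->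
  exists T, [/\ 0 < T, k T <= 0 & forall s, 0 <= s < T -> 0 < k s].
Proof.
move=> ck k0 r0 kr; pose S := [set s | 0 <= s /\ k s <= 0]%classic.
have Sr : S r by [].
have lS : has_lbound S by exists 0 => s [].
have iS : has_inf S by split => //; exists r.
have T0 : 0 <= inf S by apply: lb_le_inf; [exists r|move=> s []].
have kT : k (inf S) <= 0.
  rewrite leNgt; apply/negP => kT.
  have kT1 : 0 < k `|inf S| by rewrite ger0_norm.
  have [d /= d0 dP] := (cvgrPdist_lt _ _).1 (ck (inf S)) _ kT1.
  have [s [s0 ks] sd] := inf_adherent d0 iS.
  have sT : inf S <= s by apply: ge_inf.
  have sTd : `|inf S - s| < d by rewrite distrC ger0_norm ?subr_ge0// ltrBlDl.
  have := dP s sTd; rewrite (ger0_norm T0) (ger0_norm s0) => /ltr_normlW.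
  by rewrite ltrBlDr ltrDl ltNge ks.
exists (inf S); split => //.
  rewrite lt_neqAle T0 andbT; apply/eqP => E.
  by move: kT; rewrite -E leNgt k0.
move=> s /andP[s0 sT]; rewrite ltNge; apply/negP => ks.
by move: sT; rewrite ltNge => /negP; apply; exact: ge_inf.
Qed.

(* The biharmonic equation as a system: [h] is the profile of the Laplacian. *)
Definition rsol g p h q : Prop := [/\ forall r, 0 <= r -> 0 < g r,
  rlap g p h & rlap h q (fun r => - (g r ^+ 7)^-1)].

(* As long as [h1 < h2] one has [g1 <= g2], hence [h2 - h1] is subharmonic and
   stays above its positive initial value: its first zero cannot exist. *)
Lemma comparison g1 p1 h1 q1 g2 p2 h2 q2 :
  rsol g1 p1 h1 q1 -> rsol g2 p2 h2 q2 -> g1 0 <= g2 0 -> h1 0 < h2 0 ->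
  forall r, 0 <= r -> g1 r + (h2 0 - h1 0) * r ^+ 2 / 6 <= g2 r.
Proof.
move=> [g1p l1 m1] [g2p l2 m2] g0 h0.
have lw := rlapD l2 (rlapN l1); have lk := rlapD m2 (rlapN m1).
(* Self-improvement: if [h2 - h1] is nonnegative before [T], it keeps its initial lower bound up to
   [T]. This is used at the first zero, for a contradiction, and then on every interval. *)
have step T : (forall s, 0 < s < T -> 0 <= h2 s - h1 s) ->
    forall r, 0 <= r <= T -> h2 0 - h1 0 <= h2 r - h1 r.
  move=> kT r rT.
  have w0 s : 0 < s < T -> g1 s <= g2 s.
    move=> /andP[s0 sT]; have := @rlap_lower _ _ _ T 0 lw kT s.
    rewrite (ltW s0) (ltW sT) => /(_ isT)[+ _]; rewrite !mul0r addr0.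
    by rewrite -[g1 s <= _]subr_ge0; apply: le_trans; rewrite subr_ge0.
  have := @rlap_lower _ _ _ T 0 lk _ r rT; rewrite mul0r mul0r addr0.
  case=> // s sT; rewrite opprK addrC subr_ge0.
  have s0 : 0 <= s by case/andP: sT => /ltW.
  have h1p := g1p s s0; have h2p := g2p s s0.
  rewrite lef_pV2 ?posrE ?exprn_gt0//.
  by apply: lerXn2r; rewrite ?nnegrE ?w0 ?(ltW h1p) ?(ltW h2p).
have k0 r : 0 <= r -> 0 < h2 r - h1 r.
  move=> r0; rewrite ltNge; apply/negP => kr.
  have [||T [T0 kT sT]] := @first_zero (fun r => h2 r - h1 r) r _ _ r0 kr.
  - by case: lk.
  - by rewrite subr_gt0.
  have : h2 0 - h1 0 <= h2 T - h1 T.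
    apply: (step T); last by rewrite lexx ltW.
    by move=> s /andP[/ltW s0 sT']; rewrite ltW// sT// s0.
  by rewrite leNgt (le_lt_trans kT) ?subr_gt0.
have kd r : 0 <= r -> h2 0 - h1 0 <= h2 r - h1 r.
  move=> r0; apply: (step r); last by rewrite r0 lexx.
  by move=> s /andP[/ltW s0 _]; rewrite ltW// k0.
move=> r r0; have := @rlap_lower _ _ _ r (h2 0 - h1 0) lw _ r.
rewrite r0 lexx => -[||+ _] //; first by move=> s /andP[/ltW s0 _]; exact: kd.
by move: g0; lra.
Qed.

(** For x = 1/a and y = 1/b, x^7 - y^7 is x - y times seven monomials of degree 6, each at most
    c^-6, while |x - y| <= c^-2 |b - a|. *)
Lemma inv7_lipschitz c a b : 0 < c -> c <= a -> c <= b ->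
  `|(a ^+ 7)^-1 - (b ^+ 7)^-1| <= 7 / c ^+ 8 * `|b - a|.
Proof.
move=> c0 ca cb; have a0 := lt_le_trans c0 ca; have b0 := lt_le_trans c0 cb.
have xc z : c <= z -> 0 <= z^-1 <= c^-1.
  by move=> cz; rewrite invr_ge0 lef_pV2 ?posrE ?(lt_le_trans c0 cz)// cz ltW// (lt_le_trans c0 cz).
rewrite -!exprVn subrXX normrM.
have -> : a^-1 - b^-1 = a^-1 * b^-1 * (b - a) by field; rewrite !gt_eqF.
have /andP[a1 a2] := xc a ca; have /andP[b1 b2] := xc b cb.
rewrite normrM ger0_norm ?mulr_ge0//.
have h1 : a^-1 * b^-1 <= c^-1 ^+ 2 by rewrite expr2 ler_pM.
have h2 : `|\sum_(i < 7) a^-1 ^+ (7.-1 - i) * b^-1 ^+ i| <= 7 * c^-1 ^+ 6.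
  apply: le_trans (ler_norm_sum _ _ _) _.
  rewrite (_ : 7 * _ = \sum_(i < 7) c^-1 ^+ 6); last first.
    by rewrite sumr_const card_ord mulr_natl.
  apply: ler_sum => i _; rewrite ger0_norm ?mulr_ge0 ?exprn_ge0//.
  have -> : c^-1 ^+ 6 = c^-1 ^+ (7.-1 - i) * c^-1 ^+ i.
    have i6 : (i <= 6)%N by case: i.
    by rewrite -exprD subnK.
  rewrite ler_pM ?exprn_ge0 ?lerXn2r ?nnegrE ?invr_ge0 ?(ltW c0) ?(ltW a0) ?(ltW b0)//.
rewrite (_ : 7 * c^-1 ^+ 8 * `|b - a| = (c^-1 ^+ 2 * (7 * c^-1 ^+ 6)) * `|b - a|); last by ring.
rewrite mulrAC ler_wpM2r// ler_pM// mulr_ge0//.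
Qed.

(* With [y = r (g2 - g1)] the equation reads [y'''' = r (g1^-7 - g2^-7)], and
   [E = y^2 + y'^2 + y''^2 + y'''^2] satisfies [E' <= C E]. *)
Lemma stability c g1 p1 h1 q1 g2 p2 h2 q2 : 0 < c ->
  rsol g1 p1 h1 q1 -> rsol g2 p2 h2 q2 ->
  forall b, (forall r, 0 <= r <= b -> c <= g1 r /\ c <= g2 r) ->
  g1 0 = g2 0 -> forall r, 0 <= r <= b ->
  (r * (g2 r - g1 r)) ^+ 2 <= (h2 0 - h1 0) ^+ 2 * expR ((2 + 7 / c ^+ 8) * r).
Proof.
move=> c0 [g1p [cg1 cp1 ch1 dg1 dp1] [_ cq1 _ dh1 dq1]].
move=> [g2p [cg2 cp2 ch2 dg2 dp2] [_ cq2 _ dh2 dq2]] b gc g0 r /andP[r0 rb].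
set L := 7 / c ^+ 8; have L0 : 0 <= L by rewrite divr_ge0// exprn_ge0// ltW.
(* Since r (Delta f) = (r f)'', the functions [z], [v], [q], [n] are the successive derivatives of
   [y]. *)
pose y t := t * (g2 t - g1 t); pose z t := (g2 t - g1 t) + t ^+ 2 * (p2 t - p1 t).
pose v t := t * (h2 t - h1 t); pose q t := (h2 t - h1 t) + t ^+ 2 * (q2 t - q1 t).
pose n t := t * ((g1 t ^+ 7)^-1 - (g2 t ^+ 7)^-1).
pose E t := y t ^+ 2 + z t ^+ 2 + v t ^+ 2 + q t ^+ 2.
(* Gronwall by an integrating factor: E' <= (2 + L) E says that this function is nondecreasing. *)
pose f t := - (E t * expR (- (2 + L) * t)).
pose df t := ((2 + L) * E t - 2 * (y t * z t + z t * v t + v t * q t + q t * n t)) *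
  expR (- (2 + L) * t).
have cexp : cont0 (fun t => expR (- (2 + L) * t)).
  move=> x; apply: continuous_comp; last exact: continuous_expR.
  by apply: cvgM; [exact: cvg_cst|exact: norm_continuous].
have : f 0 <= f r.
  apply: (@cont0_mono _ f df 0 r) => //.
  - by rewrite /f /E /y /z /v /q; cont.
  - move=> t /andP[t0 tr].
    have e1 := dg1 t t0; have e2 := dp1 t t0; have e3 := dh1 t t0; have e4 := dq1 t t0.
    have e5 := dg2 t t0; have e6 := dp2 t t0; have e7 := dh2 t t0; have e8 := dq2 t t0.
    have e9 : is_derive t 1 (fun t => expR (- (2 + L) * t))
       (expR (- (2 + L) * t) * (- (2 + L))).
      have e10 : is_derive t 1 (fun t => - (2 + L) * t) (- (2 + L)).
        by drve; rewrite mulr1 mulr0 addr0.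
      exact: (@drv_comp R expR _ t _ _ (is_derive_expR _) e10).
    have yE : is_derive t 1 y (z t).
      rewrite /y; drve.
      by rewrite /z; ring.
    have zE : is_derive t 1 z (v t).
      rewrite /z; drve.
      by rewrite /v /=; field; rewrite gt_eqF.
    have vE : is_derive t 1 v (q t).
      rewrite /v; drve.
      by rewrite /q; ring.
    have qE : is_derive t 1 q (n t).
      rewrite /q; drve.
      by rewrite /n /=; field; rewrite !gt_eqF ?g1p ?g2p ?ltW.
    rewrite /f /E; drve.
    by rewrite /df /E /=; ring.
  - move=> t /andP[t0 tr]; rewrite /df mulr_ge0 ?expR_ge0//.
    have [|gc1 gc2] := gc t; first by rewrite (ltW t0) (le_trans (ltW tr)).
    have nL : `|n t| <= L * `|y t|.
      rewrite /n /y !normrM mulrCA ler_wpM2l//.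
      exact: inv7_lipschitz.
    have sq (x1 x2 : R) : 0 <= x1 ^+ 2 + x2 ^+ 2 - 2 * (x1 * x2).
      by rewrite (_ : _ - _ = (x1 - x2) ^+ 2) ?sqr_ge0//; ring.
    have h4 : 2 * (q t * n t) <= L * (q t ^+ 2 + y t ^+ 2).
      rewrite (le_trans (ler_norm _))// normrM (normrM (q t)) (@ger0_norm _ 2)//.
      have : 2 * (`|q t| * `|n t|) <= 2 * (`|q t| * (L * `|y t|)).
        by rewrite ler_wpM2l// ler_wpM2l.
      move=> /le_trans; apply; have := sq `|q t| `|y t|; rewrite !(real_normK (num_real _)) => hh.
      rewrite -subr_ge0 (_ : _ - _ = L * (q t ^+ 2 + y t ^+ 2 - 2 * (`|q t| * `|y t|))); last by ring.
      by rewrite mulr_ge0.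
    have s1 := sq (y t) (z t); have s2 := sq (z t) (v t); have s3 := sq (v t) (q t).
    have h5 : 0 <= L * (z t ^+ 2 + v t ^+ 2) by rewrite mulr_ge0// addr_ge0// sqr_ge0.
    (* Each cross term is absorbed by the two squares of its factors. The coefficient 2 + L of [E]
       leaves a sum of seven nonnegative terms. *)
    rewrite (_ : (2 + L) * E t - _ = (y t ^+ 2 + z t ^+ 2 - 2 * (y t * z t))
      + (z t ^+ 2 + v t ^+ 2 - 2 * (z t * v t))
      + (v t ^+ 2 + q t ^+ 2 - 2 * (v t * q t))
      + (L * (q t ^+ 2 + y t ^+ 2) - 2 * (q t * n t))
      + L * (z t ^+ 2 + v t ^+ 2) + y t ^+ 2 + q t ^+ 2); last by rewrite /E; ring.
    have h6 : 0 <= L * (q t ^+ 2 + y t ^+ 2) - 2 * (q t * n t) by rewrite subr_ge0.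
    by do 6![apply: addr_ge0; last by first [exact: sqr_ge0 | assumption]].
rewrite /f lerN2 mulr0 expR0 mulr1 => hE.
have {hE} : E r <= E 0 * expR ((2 + L) * r).
  rewrite -ler_pdivrMr ?expR_gt0//; apply: le_trans hE.
  by rewrite -expRN mulNr.
have -> : E 0 = (h2 0 - h1 0) ^+ 2.
  by rewrite /E /y /z /v /q g0 !mul0r !expr0n/= !mul0r subrr !addr0 expr0n !add0r.
apply: le_trans; rewrite /E /y -!addrA lerDl.
by rewrite !addr_ge0 ?sqr_ge0.
Qed.

Lemma cont0_lower g b : cont0 g -> (forall r, 0 <= r -> 0 < g r) -> 0 <= b ->
  exists2 c, 0 < c & forall r, 0 <= r <= b -> c <= g r.
Proof.
move=> cg g0 b0; have [||c cb cP] := @EVT_min _ (fun r => g `|r|) 0 b => //.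
  exact: continuous_subspaceT.
exists (g `|c|); first by rewrite g0.
by move=> r rb; have := cP r; rewrite in_itv/= => /(_ rb); rewrite (ger0_norm (andP rb).1).
Qed.

(** [stability] with zero initial gap. The lower bound it requires comes from compactness of
    [0, r]. *)
Lemma rsol_unique g1 p1 h1 q1 g2 p2 h2 q2 :
  rsol g1 p1 h1 q1 -> rsol g2 p2 h2 q2 -> g1 0 = g2 0 -> h1 0 = h2 0 ->
  forall r, 0 <= r -> g1 r = g2 r.
Proof.
move=> s1 s2 g0 h0 r; rewrite le_eqVlt => /orP[/eqP <- //|r0].
have [g1p [cg1 _ _ _ _] _] := s1; have [g2p [cg2 _ _ _ _] _] := s2.
have [c1 c10 c1P] := cont0_lower cg1 g1p (ltW r0).
have [c2 c20 c2P] := cont0_lower cg2 g2p (ltW r0).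
have m0 : 0 < Num.min c1 c2 by rewrite lt_min c10.
have := stability m0 s1 s2 (b := r) _ g0 (r := r).
rewrite h0 subrr expr0n mul0r lexx (ltW r0) => H.
have : (r * (g2 r - g1 r)) ^+ 2 <= 0.
  by apply: H => // s sr; rewrite !ge_min c1P// c2P// orbT.
rewrite le_eqVlt ltNge sqr_ge0 orbF sqrf_eq0 mulf_eq0 gt_eqF//= subr_eq0.
by move=> /eqP.
Qed.

End RadialLaplacian.

(** * Existence above a given solution *)

Section Existence.
Variable R : realType.
Implicit Types (f g w p h k q F P v G : R -> R) (r s t a b c d e x y : R).
Local Notation mu := (@lebesgue_measure R).

Lemma primitive f : cont0 f -> exists F, [/\ cont0 F, F 0 = 0 &
  forall r, 0 < r -> is_derive r 1 F (f r)].
Proof.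
(* Starting the integral at -1 makes 0 an interior point, so the primitive is continuous there as
   well. *)
move=> cf; pose F0 x := (\int[mu]_(t in `[-1, x]) f `|t|)%R.
have dF0 x : -1 < x -> is_derive x 1 F0 (f `|x|).
  move=> x1; have xx : x < x + 1 by rewrite ltrDl.
  have int : mu.-integrable `[-1, x + 1] (EFin \o (fun t => f `|t|)).
    apply: continuous_compact_integrable; first exact: segment_compact.
    exact: continuous_subspaceT.
  have [] := continuous_FTC1 xx int _ (cf x); first by rewrite /= lte_fin.
  move=> D E; apply: DeriveDef; first exact: D.
  by rewrite -derive1E; exact: E.
exists (fun x => F0 x - F0 0); split; last 2 first.
- by rewrite subrr.
- move=> r r0; have := dF0 r; rewrite gtr0_norm// => h.
  have e := h (lt_trans (ltrN10 _) r0).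
  by drve; rewrite addr0.
move=> x; apply: cvgB; last exact: cvg_cst.
apply: (@continuous_comp _ _ _ (fun r => `|r|) F0); first exact: norm_continuous.
apply: (drv_continuous (dF0 _ _)).
by apply: lt_le_trans (normr_ge0 _); exact: ltrN10.
Qed.

Lemma cont0_eq f g : (forall r, 0 <= r -> f r = g r) -> cont0 f -> cont0 g.
Proof.
by move=> fg; rewrite /cont0 (_ : (fun r => f `|r|) = fun r => g `|r|)//;
  apply/funext => r; exact: fg.
Qed.

(** Explicit inversion of the radial Laplacian: r^3 p is the primitive of r^2 f, and v - a is the
    primitive of r p. *)
Lemma solve_rlap f a : cont0 f -> exists v p, rlap v p f /\ v 0 = a.
Proof.
move=> cf; have [|P [cP P0 dP]] := @primitive (fun r => r ^+ 2 * f r).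
  by cont.
pose p r := if 0 < r then P r / r ^+ 3 else f 0 / 3.
have cp : cont0 p by exact: ratio_cont0 cP cf P0 dP.
have [|V [cV V0 dV]] := @primitive (fun r => r * p r); first by cont.
exists (fun r => a + V r), p; split; last by rewrite V0 addr0.
split=> //; first by cont.
- by move=> r r0; have e := dV r r0; drve; rewrite add0r.
- move=> r r0; apply: (@drv_eq_pos _ (fun r => P r / r ^+ 3) p) => //.
    by move=> s s0; rewrite /p s0.
  have e := dP r r0; drve; first by rewrite expf_neq0// gt_eqF.
  by rewrite /p r0; field; rewrite gt_eqF.
Qed.

Lemma rlap_eq g p h k : (forall r, 0 <= r -> h r = k r) ->
  rlap g p h -> rlap g p k.
Proof.
move=> hk [cg cp ch dg dp]; split => //; first exact: cont0_eq ch.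
by move=> r r0; rewrite -hk ?ltW//; exact: dp.
Qed.

(** The bound [B] is a parameter, not existentially quantified, so that a pointwise supremum of such
    functions obeys the same bound. *)
Definition locally_lipschitz (B : R -> R) w : Prop :=
  forall b r s, 0 <= r -> r <= s -> s <= b -> `|w s - w r| <= B b * (s - r).

Lemma lipschitz_cont0 B w : (forall b, 0 <= b -> 0 <= B b) ->
  locally_lipschitz B w -> cont0 w.
Proof.
move=> B0 lw x; apply/cvgrPdist_le => e e0.
set b := `|x| + 1; have b0 : 0 <= b by rewrite addr_ge0.
have lip r s : 0 <= r <= b -> 0 <= s <= b -> `|w r - w s| <= B b * `|r - s|.
  wlog sr : r s / s <= r.
    move=> H; case: (leP s r) => [|/ltW] sr rb sb; first exact: H.
    by rewrite distrC [`|r - s|]distrC; exact: H.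
  move=> /andP[r0 rb] /andP[s0 _]; rewrite [in leRHS]ger0_norm ?subr_ge0//.
  exact: lw.
have B1 : 0 < B b + 1 by rewrite ltr_wpDl// B0.
exists (Num.min 1 (e / (B b + 1))) => /=; first by rewrite lt_min ltr01 divr_gt0.
move=> y /=; rewrite lt_min => /andP[y1 ye].
have yb : `|y| <= b.
  rewrite -[y](subrK x) addrC (le_trans (ler_normD _ _))// lerD2l.
  by rewrite distrC ltW.
have xb : `|x| <= b by rewrite /b lerDl.
have wxy : `|w (`|x|) - w (`|y|)| <= B b * `|(`|x|) - (`|y|)|.
  by apply: lip; rewrite normr_ge0.
apply: le_trans wxy _; apply: (@le_trans _ _ ((B b + 1) * `|x - y|)).
  by apply: ler_pM; rewrite ?B0// ?lerDl// ler_dist_dist.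
by rewrite -ler_pdivlMl// mulrC ltW.
Qed.

(* [v] solves the linear problem [Delta^2 v = - w^-7] with [v = a] and
   [Delta v = b] at the origin. *)
Definition iterate a b w v : Prop := exists p h q,
  [/\ rlap v p h, rlap h q (fun r => - (w r ^+ 7)^-1), v 0 = a & h 0 = b].

Lemma iterate_exists a b w : cont0 w -> (forall r, 0 <= r -> 0 < w r) ->
  exists v, iterate a b w v.
Proof.
move=> cw w0; have [|h [q [lh h0]]] := @solve_rlap (fun r => - (w r ^+ 7)^-1) b.
  by cont => r r0; rewrite expf_neq0// gt_eqF// w0.
have [|v [p [lv v0]]] := @solve_rlap h a; first by case: lh.
by exists v, p, h, q.
Qed.

(** The map w |-> - w^-7 is increasing, and inverting the radial Laplacian with a given value at the
    origin preserves order. The inversion is applied once for [h] and once for [v]. *)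
Lemma iterate_mono a b1 b2 w1 w2 v1 v2 : b1 <= b2 ->
  (forall r, 0 <= r -> 0 < w1 r) -> (forall r, 0 <= r -> w1 r <= w2 r) ->
  iterate a b1 w1 v1 -> iterate a b2 w2 v2 -> forall r, 0 <= r -> v1 r <= v2 r.
Proof.
move=> b12 w10 w12 [p1 [h1 [q1 [lv1 lh1 v10 h10]]]] [p2 [h2 [q2 [lv2 lh2 v20 h20]]]].
have h12 r : 0 <= r -> h1 r <= h2 r.
  move=> r0; have := @rlap_lower _ _ _ _ r 0 (rlapD lh2 (rlapN lh1)) _ r.
  rewrite r0 lexx mul0r mul0r addr0 h10 h20 => H; rewrite -subr_ge0.
  apply: le_trans (H _ isT).1; first by rewrite subr_ge0.
  move=> s /andP[/ltW s0 _]; have h1p := w10 s s0; have h12p := w12 s s0.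
  rewrite opprK addrC subr_ge0 lef_pV2 ?posrE ?exprn_gt0 ?(lt_le_trans h1p)//.
  by apply: lerXn2r; rewrite ?nnegrE ?(ltW h1p) ?(le_trans (ltW h1p)).
move=> r r0; have := @rlap_lower _ _ _ _ r 0 (rlapD lv2 (rlapN lv1)) _ r.
rewrite r0 lexx mul0r mul0r addr0 v10 v20 subrr => H; rewrite -subr_ge0.
by apply: (H _ isT).1 => s /andP[/ltW s0 _]; rewrite subr_ge0 h12.
Qed.

(** The bound depends on [w] only through [c], so all iterates of functions above [c] are
    equi-Lipschitz. On [0, M] the source lies in [- c^-7, 0]; this bounds |h| by |b| + c^-7 M^2,
    then |p| by the same quantity, and finally |v'| = r |p|. *)
Lemma iterate_lipschitz a b c w v : 0 < c -> (forall r, 0 <= r -> c <= w r) ->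
  iterate a b w v ->
  locally_lipschitz (fun M => M * (`|b| + (c ^+ 7)^-1 * M ^+ 2)) v.
Proof.
move=> c0 cw [p [h [q [lv lh v0 h0]]]] M r s r0 rs sM.
have s0 := le_trans r0 rs; have M0 := le_trans s0 sM.
have c70 : 0 <= (c ^+ 7)^-1 by rewrite invr_ge0 exprn_ge0// ltW.
set A : R := (c ^+ 7)^-1; set B : R := `|b| + A * M ^+ 2.
have B0 : 0 <= B by rewrite addr_ge0// mulr_ge0// sqr_ge0.
have hB t : 0 <= t <= M -> - B <= h t <= B.
  move=> tM; have t2 : t ^+ 2 <= M ^+ 2.
    by case/andP: tM => t0 tM; rewrite lerXn2r ?nnegrE.
  have w7 x : 0 <= x -> 0 <= (w x ^+ 7)^-1 <= A.
    move=> x0; have wx := cw x x0; have wx0 := lt_le_trans c0 wx.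
    rewrite invr_ge0 exprn_ge0 ?(ltW wx0)//= lef_pV2 ?posrE ?exprn_gt0//.
    by rewrite lerXn2r ?nnegrE ?(ltW c0) ?(ltW wx0).
  have [|lo _] := rlap_lower (b := M) (d := - A) lh _ tM.
    by move=> x /andP[/ltW /w7 /andP[_ ?] _]; rewrite lerN2.
  have [|up _] := rlap_lower (b := M) (d := 0) (rlapN lh) _ tM.
    by move=> x /andP[/ltW /w7 /andP[? _] _]; rewrite opprK.
  rewrite mul0r mul0r addr0 lerN2 h0 in up; rewrite h0 in lo.
  have At : A * t ^+ 2 <= A * M ^+ 2 by rewrite ler_wpM2l.
  have A2 : 0 <= A * t ^+ 2 by rewrite mulr_ge0// sqr_ge0.
  have b1 := ler_norm b; have b2 := ler_norm (- b); rewrite normrN in b2.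
  apply/andP; rewrite /B; split; last by move: up b1 At A2; lra.
  by move: lo b2 At A2; lra.
have pB t : 0 < t <= M -> - B <= p t <= B.
  move=> /andP[t0 tM]; have tM' : 0 <= t <= M by rewrite ltW.
  have [|_ /(_ t0) lo] := rlap_lower (b := M) (d := - B) lv _ tM'.
    by move=> x /andP[/ltW x0 /ltW xM]; have := hB x; rewrite x0 xM => /(_ isT)/andP[].
  have [|_ /(_ t0) up] := rlap_lower (b := M) (d := - B) (rlapN lv) _ tM'.
    by move=> x /andP[/ltW x0 /ltW xM]; rewrite lerN2; have := hB x; rewrite x0 xM => /(_ isT)/andP[].
  by apply/andP; move: lo up B0; lra.
clearbody B; have [cv _ _ dv _] := lv.
have mono (e : R) : `|e| = 1 -> e * (v s - v r) <= M * B * (s - r).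
  move=> e1; pose f t := M * B * t - e * v t.
  have : f r <= f s.
    apply: (@cont0_mono R f (fun t => M * B - e * (t * p t)) r s);
      [by rewrite /f; cont|exact: r0|exact: rs| |].
    - move=> t /andP[rt ts]; have h1 := dv t (le_lt_trans r0 rt).
      by rewrite /f; drve; ring.
    - move=> t /andP[rt ts]; have t0 := le_lt_trans r0 rt.
      have tM : t <= M by rewrite (le_trans (ltW ts)).
      rewrite subr_ge0 (le_trans (ler_norm _))// !normrM e1 mul1r.
      rewrite (gtr0_norm t0) ler_pM ?(ltW t0)// ler_norml.
      by apply: pB; rewrite t0 tM.
  by rewrite /f; lra.
have m1 := mono 1 (normr1 _); have m2 := mono (-1) (normrN1 _).
by rewrite ler_norml; apply/andP; move: m1 m2; lra.
Qed.

(* Knaster-Tarski: among the equi-Lipschitz functions [w >= G] lying below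
   their own iterate, the pointwise supremum is a fixed point. *)
Lemma rsol_exists c G PG HG QG b : 0 < c -> rsol G PG HG QG ->
  (forall r, 0 <= r -> c <= G r) -> HG 0 <= b ->
  exists g p h q, [/\ rsol g p h q, g 0 = G 0, h 0 = b &
    forall r, 0 <= r -> G r <= g r].
Proof.
move=> c0 [G0 lG lHG] cG hb.
(* Both |HG 0| and |b| enter, so that one bound serves [G], an iterate with datum [HG 0], and the
   iterates with datum [b]. *)
pose B (M : R) := M * (`|HG 0| + `|b| + (c ^+ 7)^-1 * M ^+ 2).
have c70 : 0 <= (c ^+ 7)^-1 by rewrite invr_ge0 exprn_ge0// ltW.
have B0 M : 0 <= M -> 0 <= B M.
  by move=> M0; rewrite mulr_ge0// !addr_ge0// mulr_ge0// sqr_ge0.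
have iterG : iterate (G 0) (HG 0) G G by exists PG, HG, QG.
have lipB b' w v : (b' = HG 0 \/ b' = b) -> (forall r, 0 <= r -> c <= w r) ->
    iterate (G 0) b' w v -> locally_lipschitz B v.
  move=> hb' cw iv M r s r0 rs sM.
  apply: le_trans (iterate_lipschitz c0 cw iv r0 rs sM) _.
  have M0 := le_trans (le_trans r0 rs) sM.
  rewrite ler_wpM2r ?subr_ge0// /B ler_wpM2l// lerD2r.
  by case: hb' => ->; rewrite ?lerDl ?lerDr.
pose K w := [/\ forall r, 0 <= r -> G r <= w r, locally_lipschitz B w &
  exists2 v, iterate (G 0) b w v & forall r, 0 <= r -> w r <= v r].
have Kc w : K w -> forall r, 0 <= r -> c <= w r.
  by move=> [Gw _ _] r r0; rewrite (le_trans (cG r r0))// Gw.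
have Kpos w : K w -> forall r, 0 <= r -> 0 < w r.
  by move=> Kw r r0; apply: lt_le_trans c0 (Kc w Kw r r0).
(* Makes the supremum finite: members of [K] start at or below [G 0] and are equi-Lipschitz. *)
have Kub w r : K w -> 0 <= r -> w r <= G 0 + B r * r.
  move=> [_ lw [v [p [h [q [_ _ v0 _]]]] wv]] r0.
  have := lw r 0 r (lexx _) r0 (lexx _); rewrite subr0 => /ler_normlW.
  by have := wv 0 (lexx _); rewrite v0; lra.
have lipG : locally_lipschitz B G by apply: lipB iterG => //; left.
(* [G] is its own iterate for the datum [HG 0 <= b], hence lies below its iterate for [b]. *)
have KG : K G.
  split => //; have [|v iv] := @iterate_exists (G 0) b G _ G0; first by case: lG.
  by exists v => //; exact: iterate_mono hb G0 _ iterG iv.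
pose S r := [set w r | w in K]%classic.
have hS r : 0 <= r -> has_sup (S r).
  move=> r0; split; first by exists (G r), G.
  by exists (G 0 + B r * r) => _ [w Kw <-]; exact: Kub.
pose W r := sup (S r).
have leW w r : K w -> 0 <= r -> w r <= W r.
  by move=> Kw r0; apply: ub_le_sup; [case: (hS r r0)|exists w].
have Wle r x : 0 <= r -> (forall w, K w -> w r <= x) -> W r <= x.
  by move=> r0 H; apply: ge_sup; [case: (hS r r0)|move=> _ [w Kw <-]; exact: H].
have cW r : 0 <= r -> c <= W r.
  by move=> r0; rewrite (le_trans (cG r r0))// leW.
have W0 r : 0 <= r -> 0 < W r by move=> r0; exact: lt_le_trans c0 (cW r r0).
have lipW : locally_lipschitz B W.
  move=> M r s r0 rs sM; have s0 := le_trans r0 rs.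
  rewrite ler_norml; apply/andP; split.
    rewrite lerBrDl lerBlDr; apply: Wle => // w Kw.
    have [_ lw _] := Kw; have := lw M r s r0 rs sM; rewrite distrC => /ler_normlW.
    by have := leW w s Kw s0; lra.
  rewrite lerBlDr; apply: Wle => // w Kw.
  have [_ lw _] := Kw; have := lw M r s r0 rs sM => /ler_normlW.
  by have := leW w r Kw r0; lra.
have [v iv] := iterate_exists (G 0) b (lipschitz_cont0 B0 lipW) W0.
have Wv r : 0 <= r -> W r <= v r.
  move=> r0; apply: Wle => // w Kw; have [_ _ [u iu wu]] := Kw.
  rewrite (le_trans (wu r r0))//.
  by apply: (iterate_mono (lexx b) _ _ iu iv) => // [|s s0]; [exact: Kpos|exact: leW].
(* From [W <= v], monotonicity puts [v] below its own iterate. So [v] belongs to [K], which gives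
   the reverse inequality [v <= W]. *)
have Kv : K v.
  have v0 r : 0 <= r -> 0 < v r by move=> r0; rewrite (lt_le_trans (W0 r r0))// Wv.
  split.
  - by move=> r r0; rewrite (le_trans _ (Wv r r0))// leW.
  - by apply: lipB iv => //; right.
  - have [|u iu] := @iterate_exists (G 0) b v _ v0.
      by case: iv => p [h [q [[]]]].
    by exists u => //; exact: (iterate_mono (lexx b) W0 Wv iv iu).
have vW r : 0 <= r -> W r = v r.
  by move=> r0; apply/eqP; rewrite eq_le Wv//= leW.
have [p [h [q [lv lh v0 h0]]]] := iv.
exists v, p, h, q; split => //; last by case: Kv.
split => //; first exact: Kpos.
by apply: rlap_eq lh => r r0; rewrite vW.
Qed.

End Existence.

(** * Regularity at the origin *)

Section Regularity.
Variable R : realType.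
Implicit Types (f g w p h k q F P v G : R -> R) (r s t a b c d e x y : R).

(* [k]-fold differentiability for the operator [f |-> f' / r], continuously up
   to the origin: this is [C^k] regularity of [f] as a function of [r ^+ 2]. *)
Fixpoint Ek (k : nat) f : Prop :=
  cont0 f /\ match k with
  | 0%N => True
  | k.+1 => exists2 f1, forall r, 0 < r -> is_derive r 1 f (r * f1 r) & Ek k f1
  end.

Lemma Ek_cont0 n f : Ek n f -> cont0 f.
Proof. by case: n => [|n] []. Qed.

Lemma EkS n f : Ek n.+1 f -> Ek n f.
Proof.
elim: n f => [|n IH] f; first by case.
by move=> [cf [f1 df Ef1]]; split => //; exists f1 => //; exact: IH.
Qed.

Lemma EkC n c : Ek n (fun=> c).
Proof.
elim: n c => [|n IH] c; first by split => //; cont.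
split; first by cont.
by exists (fun=> 0) => // r _; drve; rewrite mulr0.
Qed.

Lemma EkD n f g : Ek n f -> Ek n g -> Ek n (fun r => f r + g r).
Proof.
elim: n f g => [|n IH] f g; first by move=> [cf _] [cg _]; split => //; cont.
move=> [cf [f1 df Ef1]] [cg [g1 dg Eg1]]; split; first by cont.
exists (fun r => f1 r + g1 r); last exact: IH.
move=> r r0; have hf := df r r0; have hg := dg r r0.
by drve; rewrite mulrDr.
Qed.

Lemma EkM n f g : Ek n f -> Ek n g -> Ek n (fun r => f r * g r).
Proof.
elim: n f g => [|n IH] f g; first by move=> [cf _] [cg _]; split => //; cont.
move=> Ef Eg; have Ef' := EkS Ef; have Eg' := EkS Eg.
case: Ef => cf [f1 df Ef1]; case: Eg => cg [g1 dg Eg1]; split; first by cont.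
exists (fun r => f r * g1 r + g r * f1 r); last by apply: EkD; exact: IH.
move=> r r0; have hf := df r r0; have hg := dg r r0.
by drve; ring.
Qed.

Lemma EkN n f : Ek n f -> Ek n (fun r => - f r).
Proof.
move=> Ef; rewrite (_ : (fun r => - f r) = fun r => -1 * f r).
  by apply: EkM => //; exact: EkC.
by apply/funext => r; rewrite mulN1r.
Qed.

Lemma EkV n f : (forall r, 0 <= r -> 0 < f r) -> Ek n f -> Ek n (fun r => (f r)^-1).
Proof.
move=> f0; have f0' r : 0 <= r -> f r != 0 by move=> /f0 /lt0r_neq0.
elim: n => [|n IH]; first by move=> [cf _]; split => //; cont.
move=> Ef; have EV := IH (EkS Ef); case: Ef => cf [f1 df Ef1]; split; first by cont.
exists (fun r => - (f1 r * ((f r)^-1 * (f r)^-1))).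
  move=> r r0; have hf := df r r0; drve; first exact/f0'/ltW.
  by field; exact/f0'/ltW.
by apply: EkN; apply: EkM => //; exact: EkM.
Qed.

Lemma EkX n f m : Ek n f -> Ek n (fun r => f r ^+ m).
Proof.
move=> Ef; elim: m => [|m IH]; first exact: EkC.
rewrite (_ : (fun r => _) = fun r => f r * f r ^+ m); first exact: EkM.
by apply/funext => r; rewrite exprS.
Qed.

(* If [r p' + b p = F] then [x = p' / r] solves the same equation with
   [b + 2] and [F' / r]; it is continuous at 0 as [(r^(b+2) x)' = r^(b+1) F1]. *)
Lemma Ek_ode n (b : nat) p F : cont0 p -> Ek n F ->
  (forall r, 0 < r -> is_derive r 1 p ((F r - b.+1%:R * p r) / r)) -> Ek n p.
Proof.
elim: n b p F => [|n IH] b p F cp; first by move=> _ _; split.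
move=> [cF [F1 dF EF1]] dp; split => //.
(* With the index of the statement the coefficient of [p] is b + 1, and [P] is r^(b+3) x for x = p'
   / r. *)
pose P r := r ^+ b.+1 * (F r - b.+1%:R * p r).
have dP r : 0 < r -> is_derive r 1 P (r ^+ b.+2 * F1 r).
  move=> r0; have h1 := dF r r0; have h2 := dp r r0; rewrite /P; drve.
  by rewrite /= !exprS; field; rewrite gt_eqF.
pose x r := if 0 < r then P r / r ^+ b.+3 else F1 0 / b.+3%:R.
have cx : cont0 x.
  apply: ratio_cont0 dP; [by rewrite /P; cont|exact: Ek_cont0 EF1|].
  by rewrite /P expr0n mul0r.
exists x; first move=> r r0.
  apply: drvE (dp r r0) _; rewrite /x r0 /P.
  by rewrite !exprS; field; rewrite ?expf_neq0 ?gt_eqF.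
apply: (IH b.+2 x F1 cx EF1) => r r0.
apply: (@drv_eq_pos _ (fun r => P r / r ^+ b.+3) x) => //.
  by move=> s s0; rewrite /x s0.
have h := dP r r0; drve; first by rewrite expf_neq0// gt_eqF.
rewrite /x r0 /= !exprS; field.
by rewrite ?expf_neq0 ?gt_eqF.
Qed.

Lemma rlap_Ek n g p h : rlap g p h -> Ek n h -> Ek n.+1 g.
Proof.
move=> [cg cp ch dg dp] Eh; split => //; exists p => //.
exact: (Ek_ode (b := 2) cp Eh dp).
Qed.

(** Bootstrap: each equation gains one order of [Ek], and g^-7 inherits the regularity of g because
    g is positive. *)
Lemma rsol_Ek n g p h q : rsol g p h q -> Ek n g /\ Ek n h.
Proof.
move=> [g0 lg lh]; elim: n => [|n [Eg Eh]].
  by case: lg => cg _ ch _ _.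
split; first exact: rlap_Ek lg Eh.
apply: rlap_Ek lh _; apply: EkN; apply: EkV => [r r0|]; last exact: EkX.
by rewrite exprn_gt0// g0.
Qed.

End Regularity.

(** * Radial functions on R^3 *)

Section Space.
Variable R : realType.
Local Notation coord := Defs.coord.
Implicit Types (u v : R3 R -> R) (p : R3 R) (i j : 'I_3) (r t : R) (f g : R -> R).

Let i0 : 'I_3 := @Ordinal 3 0 isT.
Let i1 : 'I_3 := @Ordinal 3 1 isT.
Let i2 : 'I_3 := @Ordinal 3 2 isT.

Lemma ord3_ind (P : 'I_3 -> Prop) : P i0 -> P i1 -> P i2 -> forall i, P i.
Proof.
move=> P0 P1 P2 [[|[|[|m]]] Hi]; last by exfalso.
- by rewrite (_ : Ordinal Hi = i0)//; exact/val_inj.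
- by rewrite (_ : Ordinal Hi = i1)//; exact/val_inj.
- by rewrite (_ : Ordinal Hi = i2)//; exact/val_inj.
Qed.

Lemma upd_coord i p : upd i p (coord i p) = p.
Proof. by elim/ord3_ind: i; case: p => [[]]. Qed.

Lemma coord_upd i p t : coord i (upd i p t) = t.
Proof. by elim/ord3_ind: i. Qed.

Lemma enorm_ge0 p : 0 <= enorm p.
Proof. exact: sqrtr_ge0. Qed.

Lemma enorm_sqr p : enorm p ^+ 2 = p.1.1 ^+ 2 + p.1.2 ^+ 2 + p.2 ^+ 2.
Proof. by rewrite sqr_sqrtr// !addr_ge0// sqr_ge0. Qed.

Lemma enorm_axis t : enorm ((t, 0), 0) = `|t|.
Proof. by rewrite /enorm/= !expr0n/= !addr0 sqrtr_sqr. Qed.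

Lemma enorm_eq0 p : enorm p = 0 -> p = ((0, 0), 0).
Proof.
move=> p0; have := enorm_sqr p; rewrite p0 expr0n/= => /esym/eqP.
case: p {p0} => [[x y] z] /=.
rewrite !paddr_eq0 ?addr_ge0 ?sqr_ge0// !sqrf_eq0.
by move=> /andP[/andP[/eqP-> /eqP->] /eqP->].
Qed.

Lemma enorm_upd i p t :
  enorm (upd i p t) = Num.sqrt (enorm p ^+ 2 - coord i p ^+ 2 + t ^+ 2).
Proof.
rewrite enorm_sqr /enorm; congr Num.sqrt.
by elim/ord3_ind: i; rewrite /coord/=; ring.
Qed.

Lemma coord_continuous i : continuous (@coord R i).
Proof.
elim/ord3_ind: i => p; rewrite /coord /=.
- by apply: (@continuous_comp _ _ _ fst fst); exact: cvg_fst.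
- by apply: (@continuous_comp _ _ _ fst snd); [exact: cvg_fst|exact: cvg_snd].
- exact: cvg_snd.
Qed.

Lemma enorm_continuous : continuous (@enorm R).
Proof.
move=> p; apply: (@continuous_comp _ _ _
  (fun p : R3 R => coord i0 p ^+ 2 + coord i1 p ^+ 2 + coord i2 p ^+ 2) Num.sqrt);
  last exact: sqrt_continuous.
have c i : {for p, continuous (fun q => coord i q ^+ 2)}.
  apply: (@continuous_comp _ _ _ (coord i) (fun x => x ^+ 2)).
    exact: coord_continuous.
  exact: exprn_continuous.
by apply: cvgD; [apply: cvgD|]; exact: c.
Qed.

Lemma radial_continuous f : cont0 f -> continuous (f \o @enorm R).
Proof.
move=> cf; rewrite (_ : f \o _ = (fun r => f `|r|) \o @enorm R).
  by move=> p; apply: continuous_comp; [exact: enorm_continuous|exact: cf].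
by apply/funext => p; rewrite /= ger0_norm// enorm_ge0.
Qed.

Lemma partialE i u p d : is_derive (coord i p) 1 (line i u p) d ->
  derivable (line i u p) (coord i p) 1 /\ partial i u p = d.
Proof. by move=> h; split; [exact: ex_derive|rewrite /partial derive1E derive_val]. Qed.

Lemma drv_partial i u p : derivable (line i u p) (coord i p) 1 ->
  is_derive (coord i p) 1 (line i u p) (partial i u p).
Proof. by move=> h; rewrite /partial derive1E; exact: derivableP. Qed.

Lemma radial_drv i f p d : 0 < enorm p ->
  is_derive (enorm p) 1 f (enorm p * d) ->
  is_derive (coord i p) 1 (line i (f \o @enorm R) p) (coord i p * d).
Proof.
move=> p0 df; set s := enorm p ^+ 2 - coord i p ^+ 2.
rewrite [X in is_derive _ _ X](_ : _ = fun t => f (Num.sqrt (s + t ^+ 2))); last first.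
  by apply/funext => t; rewrite /line /= enorm_upd.
have sE : s + coord i p ^+ 2 = enorm p ^+ 2 by rewrite subrK.
have h1 : is_derive (coord i p) 1 (fun t => s + t ^+ 2) (2 * coord i p).
  by drve; rewrite /=; ring.
have h2 : is_derive (coord i p) 1 (fun t => Num.sqrt (s + t ^+ 2))
    (coord i p / enorm p).
  apply: drvE; first apply: (@drv_comp R Num.sqrt _ _ _ _ _ h1).
    by rewrite sE; apply: is_derive1_sqrt; rewrite exprn_gt0.
  by rewrite sqrtr_sqr gtr0_norm//; field; rewrite gt_eqF.
apply: drvE; first apply: (@drv_comp R f _ _ (enorm p * d) _ _ h2).
  by rewrite sE sqrtr_sqr gtr0_norm.
by field; rewrite gt_eqF.
Qed.

(** As f' = r f1 with f1 bounded near 0, f(r) - f(0) = O(r^2). The even extension of f therefore has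
    derivative 0 at the origin. *)
Lemma drv_norm0 f f1 : cont0 f -> cont0 f1 ->
  (forall r, 0 < r -> is_derive r 1 f (r * f1 r)) ->
  is_derive (0 : R) 1 (fun t => f `|t|) 0.
Proof.
move=> cf cf1 df; have [d d0 dP] := cont0_near0 cf1 (@ltr01 R).
set K : R := `|f1 0| + 1; have K0 : 0 <= K by rewrite addr_ge0.
have f1K r : 0 <= r < d -> `|f1 r| <= K.
  move=> rd; rewrite -[f1 r](subrK (f1 0)) addrC (le_trans (ler_normD _ _))//.
  by rewrite lerD2l dP.
have fK r : 0 <= r < d -> `|f r - f 0| <= K * r ^+ 2.
  move=> /andP[r0 rd].
  have mono (e : R) : `|e| = 1 -> e * (f r - f 0) <= K * r ^+ 2.
    move=> e1; pose F t := K * t ^+ 2 - e * f t.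
    have : F 0 <= F r.
      apply: (@cont0_mono R F (fun t => t * (2 * K - e * f1 t)) 0 r) => //.
      - by rewrite /F; cont.
      - by move=> t /andP[t0 tr]; have h := df t t0; rewrite /F; drve; rewrite /=; ring.
      - move=> t /andP[t0 tr]; rewrite mulr_ge0 ?(ltW t0)// subr_ge0.
        rewrite (le_trans (ler_norm _))// normrM e1 mul1r.
        rewrite (le_trans (f1K _ _)) ?(ltW t0) ?(lt_trans tr)//.
        by rewrite ler_peMl// ler1n.
    by rewrite /F expr0n/= mulr0; lra.
  have m1 := mono 1 (normr1 _); have m2 := mono (-1) (normrN1 _).
  by rewrite ler_norml; apply/andP; move: m1 m2; lra.
apply/is_derive1_caratheodory.
exists (fun t => (f `|t| - f 0) / t); split.
- move=> z; have [->|z0] := eqVneq z 0; first by rewrite normr0 !subrr mulr0.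
  by rewrite normr0 subr0 divfK.
- apply/cvgrPdist_le => e e0 /=; rewrite invr0 mulr0.
  have K1 : 0 < K + 1 by rewrite ltr_wpDl.
  exists (Num.min d (e / (K + 1))) => /=; first by rewrite lt_min d0 divr_gt0.
  move=> t /=; rewrite !sub0r !normrN lt_min => /andP[td te].
  have [->|t0] := eqVneq t 0; first by rewrite invr0 mulr0 normr0 ltW.
  have nt : 0 < `|t| by rewrite normr_gt0.
  rewrite normrM normfV ler_pdivrMr//.
  apply: le_trans (fK _ _) _; first by rewrite normr_ge0.
  rewrite expr2 mulrA ler_wpM2r//.
  move: te; rewrite ltr_pdivlMr// => te; apply: le_trans (ltW te).
  by rewrite mulrC ler_wpM2l// lerDl.
- by rewrite normr0 subrr mul0r.
Qed.

Lemma radial_drv_all i f f1 p : cont0 f -> cont0 f1 ->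
  (forall r, 0 < r -> is_derive r 1 f (r * f1 r)) ->
  is_derive (coord i p) 1 (line i (f \o @enorm R) p) (coord i p * f1 (enorm p)).
Proof.
move=> cf cf1 df; have := enorm_ge0 p; rewrite le_eqVlt => /orP[/eqP/esym p0|p0].
  have -> : coord i p = 0.
    by rewrite (enorm_eq0 p0); elim/ord3_ind: i.
  rewrite mul0r [X in is_derive _ _ X](_ : _ = fun t => f `|t|); first exact: drv_norm0 df.
  apply/funext => t; rewrite /line /= enorm_upd p0.
  have -> : coord i p = 0.
    by rewrite (enorm_eq0 p0); elim/ord3_ind: i.
  by rewrite expr0n/= subrr add0r sqrtr_sqr.
by apply: radial_drv => //; exact: df.
Qed.

Lemma CkS n u : Ck n.+1 u -> Ck n u.
Proof.
elim: n u => [|n IH] u; first by case.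
by move=> [cu H]; split => // i; have [du Cu] := H i; split => //; exact: IH.
Qed.

Lemma Ck_continuous n u : Ck n u -> continuous u.
Proof. by case: n => [//|n []]. Qed.

Lemma CkC n c : Ck n (fun _ : R3 R => c).
Proof.
elim: n c => [|n IH] c; first by move=> p; exact: cvg_cst.
split; first by move=> p; exact: cvg_cst.
have dc i p : is_derive (coord i p) 1 (line i (fun=> c) p) 0 by exact: drvC.
move=> i; split; first by move=> p; exact: (partialE (dc i p)).1.
rewrite (_ : partial i _ = fun=> 0)//.
by apply/funext => p; exact: (partialE (dc i p)).2.
Qed.

Lemma Ck_coord n i : Ck n (@coord R i).
Proof.
case: n => [|n]; first exact: coord_continuous.
split; first exact: coord_continuous.
have dc j p : is_derive (coord j p) 1 (line j (@coord R i) p) ((i == j)%:R).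
  by elim/ord3_ind: i; elim/ord3_ind: j; rewrite /line /coord /upd /=;
    first [exact: drvI|exact: drvC].
move=> j; split; first by move=> p; exact: (partialE (dc j p)).1.
rewrite (_ : partial j _ = fun=> (i == j)%:R); first exact: CkC.
by apply/funext => p; exact: (partialE (dc j p)).2.
Qed.

Lemma CkD n u v : Ck n u -> Ck n v -> Ck n (fun p => u p + v p).
Proof.
elim: n u v => [|n IH] u v; first by move=> cu cv p; apply: cvgD; [exact: cu|exact: cv].
move=> [cu Hu] [cv Hv]; split; first by move=> p; apply: cvgD; [exact: cu|exact: cv].
move=> i; have [du Cu] := Hu i; have [dv Cv] := Hv i.
have d p : is_derive (coord i p) 1 (line i (fun p => u p + v p) p)
    (partial i u p + partial i v p).
  by apply: drvD; apply: drv_partial; [exact: du|exact: dv].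
split; first by move=> p; exact: (partialE (d p)).1.
rewrite (_ : partial i _ = fun p => partial i u p + partial i v p); first exact: IH.
by apply/funext => p; exact: (partialE (d p)).2.
Qed.

Lemma CkM n u v : Ck n u -> Ck n v -> Ck n (fun p => u p * v p).
Proof.
elim: n u v => [|n IH] u v; first by move=> cu cv p; apply: cvgM; [exact: cu|exact: cv].
move=> Eu Ev; have Eu' := CkS Eu; have Ev' := CkS Ev.
move: Eu Ev => [cu Hu] [cv Hv]; split; first by move=> p; apply: cvgM; [exact: cu|exact: cv].
move=> i; have [du Cu] := Hu i; have [dv Cv] := Hv i.
have d p : is_derive (coord i p) 1 (line i (fun p => u p * v p) p)
    (u p * partial i v p + v p * partial i u p).
  have := drvM (drv_partial (du p)) (drv_partial (dv p)).
  by rewrite /line !upd_coord.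
split; first by move=> p; exact: (partialE (d p)).1.
rewrite (_ : partial i _ = fun p => u p * partial i v p + v p * partial i u p).
  by apply: CkD; exact: IH.
by apply/funext => p; exact: (partialE (d p)).2.
Qed.

Lemma partial_radial i f f1 : cont0 f -> cont0 f1 ->
  (forall r, 0 < r -> is_derive r 1 f (r * f1 r)) ->
  partial i (f \o @enorm R) = fun p => coord i p * f1 (enorm p).
Proof.
move=> cf cf1 df; apply/funext => p.
exact: (partialE (radial_drv_all i p cf cf1 df)).2.
Qed.

(** The i-th partial derivative is x_i f1(|x|): a coordinate times a radial function with one order
    of [Ek] less. *)
Lemma Ck_radial n f : Ek n f -> Ck n (f \o @enorm R).
Proof.
elim: n f => [|n IH] f; first by move=> [cf _]; exact: radial_continuous.
move=> [cf [f1 df Ef1]]; split; first exact: radial_continuous.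
have cf1 := Ek_cont0 Ef1; move=> i; split.
  by move=> p; exact: (partialE (radial_drv_all i p cf cf1 df)).1.
rewrite (partial_radial i cf cf1 df).
by apply: CkM; [exact: Ck_coord|exact: IH].
Qed.

(** Sums the derivatives of x_i f1, namely f1 + x_i^2 f2. The first hypothesis is local, so the
    formula also applies where g' / r is controlled only away from the origin. *)
Lemma laplacian_at u f1 f2 p :
  (forall i, \forall t \near coord i p,
     partial i u (upd i p t) = t * f1 (enorm (upd i p t))) ->
  (forall i, is_derive (coord i p) 1 (line i (f1 \o @enorm R) p)
     (coord i p * f2 (enorm p))) ->
  laplacian u p = 3 * f1 (enorm p) + enorm p ^+ 2 * f2 (enorm p).
Proof.
move=> pu df1.
have E i : partial i (partial i u) p = f1 (enorm p) + coord i p ^+ 2 * f2 (enorm p).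
  apply: (partialE _).2.
  apply: near_eq_is_derive.
    by near=> t; rewrite /line; apply/esym; near: t; exact: pu.
  have h : is_derive (coord i p) 1 (fun t => f1 (enorm (upd i p t))) _ := df1 i.
  by drve; rewrite upd_coord; ring.
rewrite /laplacian !big_ord_recr big_ord0 /= !E enorm_sqr /coord /=; ring.
Unshelve. all: by end_near. Qed.

Lemma laplacian_radial f k1 (h : R -> R) : rlap f k1 h -> (exists2 k2, cont0 k2 &
    forall r, 0 < r -> is_derive r 1 k1 (r * k2 r)) ->
  laplacian (f \o @enorm R) = h \o @enorm R.
Proof.
move=> [cf cp ch df dp] [k2 cp2 dp2]; apply/funext => p /=.
have df1 i := radial_drv_all i p cp cp2 dp2.
rewrite (laplacian_at _ df1) => [|i]; last first.
  by near=> t; rewrite (partial_radial i cf cp df) coord_upd.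
(* For r > 0 the two expressions for the derivative of [k1] force [k r = 0]; continuity then gives
   [k 0 = 0]. *)
pose k r := 3 * k1 r + r ^+ 2 * k2 r - h r.
suff k0 r : 0 <= r -> k r = 0.
  by have := k0 _ (enorm_ge0 p); rewrite /k => /subr0_eq.
have kp t : 0 < t -> k t = 0.
  move=> t0; have [_ e1] := dp2 t t0; have [_ e2] := dp t t0.
  move: e2; rewrite e1 /k => /(congr1 (fun z => z * t)).
  by rewrite divfK ?gt_eqF// => e; rewrite -[h t](subrK (3 * k1 t)) -e; ring.
rewrite le_eqVlt => /orP[/eqP <-|]; last exact: kp.
have ck : cont0 k by rewrite /k; cont.
apply/eqP; rewrite -normr_le0; apply/ler_addgt0Pl => e e0; rewrite addr0.
have [d d0 dP] := cont0_near0 ck e0.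
have d2 : 0 < d / 2 by rewrite divr_gt0.
have := dP (d / 2); rewrite (kp _ d2) sub0r normrN; apply.
by rewrite (ltW d2) ltr_pdivrMr// ltr_pMr// ltr1n.
Unshelve. all: by end_near. Qed.

Lemma rsol_pos_radial g (k h q : R -> R) : rsol g k h q ->
  pos_radial_solution (g \o @enorm R).
Proof.
move=> s; have [g0 lg lh] := s; have EE n := rsol_Ek n s.
have step f f1 h1 : rlap f f1 h1 -> (forall n, Ek n h1) ->
    laplacian (f \o @enorm R) = h1 \o @enorm R.
  move=> l Ekk; apply: (laplacian_radial l); have [cf cp ch df dp] := l.
  have [_ [p2 dp2 [cp2 _]]] := Ek_ode (n := 1) (b := 2) cp (Ekk 1%N) dp.
  by exists p2.
split; first by move=> n; apply: Ck_radial; case: (EE n).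
split; first by move=> x y xy; rewrite /= xy.
split; first by move=> x; exact/g0/enorm_ge0.
move=> x; rewrite /bilaplacian (step _ _ _ lg) ?(step _ _ _ lh)//.
- move=> n; apply: EkN; apply: EkV; last by apply: EkX; case: (EE n).
  by move=> r r0; rewrite exprn_gt0// g0.
- by move=> n; case: (EE n).
Qed.

Definition profile u : R -> R := fun t => u ((t, 0), 0).

Lemma radialE u : radial u -> u = profile u \o @enorm R.
Proof.
move=> ru; apply/funext => p; apply: ru.
by rewrite enorm_axis ger0_norm// enorm_ge0.
Qed.

Lemma axis_continuous : continuous (fun t : R => ((t, 0), 0) : R3 R).
Proof.
move=> t; have h0 : (0 @[_ --> t] --> (0 : R))%classic by exact: cvg_cst.
exact: cvg_pair (cvg_pair cvg_id h0) h0.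
Qed.

Lemma profile_cont0 u : continuous u -> cont0 (profile u).
Proof.
move=> cu t; apply: (@continuous_comp _ _ _ (fun t : R => `|t|) (profile u)).
  exact: norm_continuous.
by apply: (@continuous_comp _ _ _ _ u); [exact: axis_continuous|exact: cu].
Qed.

Lemma Ck_partial n i u : Ck n.+1 u -> Ck n (partial i u).
Proof. by move=> [_ /(_ i) []]. Qed.

Lemma smooth_laplacian u : smooth u -> smooth (laplacian u).
Proof.
move=> su n; rewrite /laplacian.
rewrite (_ : (fun p => _) = fun p => 0 + partial ord0 (partial ord0 u) p
   + partial i1 (partial i1 u) p
   + partial i2 (partial i2 u) p).
  by do 3![apply: CkD; last by do 2!apply: Ck_partial; exact: su]; exact: CkC.
apply/funext => p; rewrite !big_ord_recr big_ord0 /=.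
by congr (_ + _ + _ + _); congr (partial _ (partial _ _) _); apply/val_inj.
Qed.

Lemma profile_drv u t : Ck 1 u ->
  is_derive t 1 (profile u) (profile (partial ord0 u) t).
Proof.
by move=> [_ /(_ ord0) [/(_ ((t, 0), 0)) du _]]; exact: drv_partial du.
Qed.

(** Away from the origin the Laplacian is computed from the profile. At the origin, continuity of
    the Laplacian [h] and (r^2 g')' = r^2 h for r > 0 determine the limit h(0) / 3 of g' / r. *)
Lemma smooth_radial_rlap u : smooth u -> radial u ->
  radial (laplacian u) /\ exists k, rlap (profile u) k (profile (laplacian u)).
Proof.
move=> su ru; set g := profile u.
pose g1 := profile (partial ord0 u).
pose g2 := profile (partial ord0 (partial ord0 u)).
have dg t : is_derive t 1 g (g1 t) by apply: profile_drv; exact: su.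
have dg1 t : is_derive t 1 g1 (g2 t).
  by apply: profile_drv; apply: Ck_partial; exact: su.
pose f1 r := g1 r / r; pose f2 r := (g2 r - g1 r / r) / r ^+ 2.
have df1 r : 0 < r -> is_derive r 1 f1 (r * f2 r).
  move=> r0; have h := dg1 r; rewrite /f1; drve; first by rewrite gt_eqF.
  by rewrite /f2; field; rewrite gt_eqF.
have E p : 0 < enorm p ->
    laplacian u p = 3 * f1 (enorm p) + enorm p ^+ 2 * f2 (enorm p).
  move=> p0; apply: laplacian_at => i; last by apply: radial_drv => //; exact: df1.
  have : \forall t \near coord i p, 0 < enorm (upd i p t).
    have c : {for coord i p, continuous (fun t => enorm (upd i p t))}.
      rewrite (_ : (fun t => _) =
        fun t => Num.sqrt (enorm p ^+ 2 - coord i p ^+ 2 + t ^+ 2)); last first.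
        by apply/funext => t; rewrite enorm_upd.
      apply: (@continuous_comp _ _ _ _ Num.sqrt); last exact: sqrt_continuous.
      by apply: cvgD; [exact: cvg_cst|exact: exprn_continuous].
    by apply: (c [set x | 0 < x]%classic); apply: lt_nbhsr; rewrite upd_coord.
  apply: filterS => t t0; rewrite [in LHS](radialE ru) -/g.
  apply: (partialE _).2.
  set q := upd i p t; rewrite (_ : t * _ = coord i q * f1 (enorm q)).
    apply: radial_drv => //.
    by apply: drvE (dg _) _; rewrite /f1 mulrC divfK// gt_eqF.
  by rewrite coord_upd.
have rL : radial (laplacian u).
  move=> p q pq; have := enorm_ge0 p; rewrite le_eqVlt => /orP[/eqP/esym p0|p0].
    by rewrite (enorm_eq0 p0); rewrite pq in p0; rewrite (enorm_eq0 p0).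
  by rewrite !E -?pq.
split => //; set h := profile (laplacian u).
have hE r : 0 < r -> h r = g2 r + 2 * g1 r / r.
  move=> r0; rewrite /h /profile E enorm_axis gtr0_norm// /f1 /f2.
  by field; rewrite gt_eqF.
have ch : cont0 h by apply/profile_cont0/(Ck_continuous (n := 0)); exact: smooth_laplacian.
have cg : cont0 g by apply/profile_cont0/(Ck_continuous (n := 0)); exact: su.
have cg1 : cont0 g1.
  by apply/profile_cont0/(Ck_continuous (n := 0))/Ck_partial; exact: su.
pose P r := r ^+ 2 * g1 r.
have dP r : 0 < r -> is_derive r 1 P (r ^+ 2 * h r).
  move=> r0; have e := dg1 r; rewrite /P; drve.
  by rewrite hE//=; field; rewrite gt_eqF.
pose k r := if 0 < r then P r / r ^+ 3 else h 0 / 3.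
have kE r : 0 < r -> k r = f1 r.
  by move=> r0; rewrite /k r0 /P /f1; field; rewrite gt_eqF.
exists k; split => //.
- apply: ratio_cont0 dP => //; first by rewrite /P; cont.
  by rewrite /P expr0n mul0r.
- by move=> r r0; apply: drvE (dg r) _; rewrite kE// /f1 mulrC divfK// gt_eqF.
- move=> r r0; apply: (@drv_eq_pos _ f1) => //; first by move=> s s0; rewrite kE.
  apply: drvE (df1 r r0) _; rewrite kE// hE// /f2 /f1.
  by field; rewrite gt_eqF.
Qed.

Lemma pos_radial_rsol u : pos_radial_solution u ->
  exists k h q, rsol (profile u) k h q.
Proof.
move=> [su [ru [u0 bu]]].
have [rL [k lk]] := smooth_radial_rlap su ru.
have [_ [q lq]] := smooth_radial_rlap (smooth_laplacian su) rL.
exists k, (profile (laplacian u)), q; split => // [r _|]; first exact: u0.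
by apply: rlap_eq lq => r _; exact: bu.
Qed.

End Space.

(** * Integrals of radial functions *)

Section Tonelli.
Local Open Scope classical_set_scope.
Local Open Scope ereal_scope.
Variables (R : realType) (d : measure_display) (T : measurableType d).
Variable m : {sigma_finite_measure set T -> \bar R}.

Lemma sigma_finite_square : sigma_finite setT (m \x m).
Proof.
have /sigma_finiteP[F [FT ndF Foo]] := sigma_finiteT m.
exists (fun n => F n `*` F n).
  apply/seteqP; split=> // -[x y] _.
  have : [set: T] x by [].
  have : [set: T] y by [].
  rewrite FT => -[j _ Fy] [i _ Fx]; exists (maxn i j) => //; split => /=.
  - by move: x Fx; apply/subsetPset/ndF/leq_maxl.
  - by move: y Fy; apply/subsetPset/ndF/leq_maxr.
move=> n; have [mF Fn] := Foo n; split; first exact: measurableX.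
by rewrite product_measure1E// lte_mul_pinfty// ge0_fin_numE.
Qed.

Lemma cube_measure (A : set T) : measurable A ->
  ((m \x m) \x m) ((A `*` A) `*` A) = m A * m A * m A.
Proof.
move=> mA; rewrite (product_measure1E (m \x m) m)//; last exact: measurableX.
by congr (_ * _); exact: (product_measure1E m m mA mA).
Qed.

Variable f : (T * T) * T -> \bar R.
Hypotheses (mf : measurable_fun setT f) (f0 : forall p, 0 <= f p).

Let F1 := fubini_F m f.
Let mF1 : measurable_fun setT F1.
Proof. by apply: measurable_fun_fubini_tonelli_F. Qed.
Let F10 p : 0 <= F1 p. Proof. by apply: integral_ge0. Qed.

Lemma measurable_inner x y : measurable_fun setT (fun z => f ((x, y), z)).
Proof. exact: measurable_fun_pair2. Qed.

Lemma measurable_middle x : measurable_fun setT (fun y => \int[m]_z f ((x, y), z)).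
Proof. exact: measurable_fun_pair2 mF1. Qed.

Lemma measurable_outer :
  measurable_fun setT (fun x => \int[m]_y \int[m]_z f ((x, y), z)).
Proof. by have := @measurable_fun_fubini_tonelli_F _ _ _ _ R m F1 mF1 F10. Qed.

(* The library's canonical sigma-finite structure on [m1 \x m2] only applies
   to probability measures, so it is repackaged here. *)
Lemma tonelli3 :
  \int[(m \x m) \x m]_p f p = \int[m]_x \int[m]_y \int[m]_z f ((x, y), z).
Proof.
have [M ME] : exists M : {sigma_finite_measure set (T * T)%type -> \bar R},
    (M : set (T * T) -> \bar R) = m \x m.
  pose mix := Measure_isSigmaFinite.Build _ _ _ (m \x m) sigma_finite_square.
  by exists (HB.pack_for {sigma_finite_measure set (T * T)%type -> \bar R} (m \x m) mix).
have E : \int[(m \x m) \x m]_p f p = \int[M \x m]_p f p by rewrite ME.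
rewrite E (fubini_tonelli1 (m1 := M) (m2 := m))// ME.
by rewrite (fubini_tonelli1 (m1 := m) (m2 := m)).
Qed.

End Tonelli.

(** * Integrals of profiles over R^3: scaling, strict monotonicity, limits *)

Section RadialIntegral.
Local Open Scope classical_set_scope.
Variable R : realType.
Implicit Types (f g F : R -> R) (r s t l : R).
Local Notation R1 := (measurableTypeR R).
Local Notation T3 := ((R1 * R1) * R1)%type.
Local Notation mu := (@lebesgue_measure R).
Local Notation nu := ((mu \x mu) \x mu)%E.

(** [l] times the image of Lebesgue measure under x |-> l x agrees with Lebesgue measure on
    half-open intervals, hence everywhere. *)
Lemma lebesgue_integral_scale (h : R1 -> \bar R) l : 0 < l ->
  measurable_fun setT h -> (forall x, (0 <= h x)%E) ->
  (\int[mu]_x h x = l%:E * \int[mu]_x h (l * x)%R)%E.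
Proof.
move=> l0 mh h0; pose phi : R1 -> R1 := fun x => l * x.
have mphi : measurable_fun setT phi.
  by apply: measurable_funM => //; exact: measurable_cst.
pose k : {nonneg R} := NngNum (ltW l0).
pose P : {measure set R1 -> \bar R} :=
  measure_function_pushforward__canonical__measure_function_Measure mu mphi.
have E (A : set R1) : measurable A -> mu A = mscale k P A.
  move=> mA; apply: lebesgue_measure_unique => // _ [[a b]] _ <-.
  change (mu `]a, b] = (l%:E * mu (phi @^-1` `]a, b]))%E).
  have -> : phi @^-1` `]a, b] = `]a / l, b / l].
    apply/seteqP; split=> x /=; rewrite !in_itv/= /phi ltr_pdivrMr// ler_pdivlMr//;
    by rewrite [x * l]mulrC.
  rewrite !lebesgue_measure_itv /= !lte_fin ltr_pM2r ?invr_gt0//.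
  case: ifP => _; last by rewrite mule0.
  by rewrite -!EFinB -EFinM; congr EFin; field; rewrite gt_eqF.
rewrite (eq_measure_integral (mscale k P)); last by move=> A mA _; exact: E.
rewrite ge0_integral_mscale//; congr (_ * _)%E.
by rewrite ge0_integral_pushforward// preimage_setT.
Qed.

Lemma measurable_enorm : measurable_fun setT (fun p : T3 => enorm p).
Proof.
have ms : measurable_fun setT (Num.sqrt : R1 -> R1).
  by apply: continuous_measurable_fun; exact: sqrt_continuous.
have h1 : measurable_fun setT (fun p : T3 => p.1.1).
  exact: (measurableT_comp measurable_fst measurable_fst).
have h2 : measurable_fun setT (fun p : T3 => p.1.2).
  exact: (measurableT_comp measurable_snd measurable_fst).
have h3 : measurable_fun setT (fun p : T3 => p.2) by exact: measurable_snd.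
have mq : measurable_fun setT (fun p : T3 => p.1.1 ^+ 2 + p.1.2 ^+ 2 + p.2 ^+ 2).
  by apply: measurable_funD; [apply: measurable_funD|]; exact: measurable_funX.
exact: (measurableT_comp ms mq).
Qed.

Lemma measurable_radial f : cont0 f ->
  measurable_fun setT (fun p : T3 => (f (enorm p))%:E).
Proof.
move=> cf; apply/measurable_EFinP.
rewrite (_ : (fun p => _) = (fun r => f `|r|) \o (fun p : T3 => enorm p)); last first.
  by apply/funext => p; rewrite /= ger0_norm// enorm_ge0.
apply: measurableT_comp; last exact: measurable_enorm.
exact: continuous_measurable_fun.
Qed.

Definition rint f : \bar R := (\int[nu]_p (f (enorm p))%:E)%E.

Lemma rint_ge0 f : (forall r, 0 <= r -> 0 <= f r) -> (0 <= rint f)%E.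
Proof. by move=> f0; apply: integral_ge0 => p _; rewrite lee_fin f0// enorm_ge0. Qed.

Lemma rint_le f g : cont0 f -> cont0 g ->
  (forall r, 0 <= r -> 0 <= f r) -> (forall r, 0 <= r -> f r <= g r) ->
  (rint f <= rint g)%E.
Proof.
move=> cf cg f0 fg; apply: ge0_le_integral => //.
- by move=> p _; rewrite lee_fin f0// enorm_ge0.
- exact: measurable_radial.
- exact: measurable_radial.
- by move=> p _; rewrite lee_fin fg// enorm_ge0.
Qed.

Lemma enorm_scale l (p : R3 R) : 0 <= l -> enorm (scale3 l p) = l * enorm p.
Proof.
move=> l0; rewrite /enorm /scale3/= !exprMn -!mulrDr sqrtrM ?sqr_ge0//.
by rewrite sqrtr_sqr ger0_norm.
Qed.

(** One-dimensional scaling in each of the three iterated integrals; each contributes a factor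
    [l]. *)
Lemma rint_scale f l : 0 < l -> cont0 f -> (forall r, 0 <= r -> 0 <= f r) ->
  rint f = ((l ^+ 3)%:E * rint (fun r => f (l * r)%R))%E.
Proof.
move=> l0 cf f0; have l1 := ltW l0.
have cfl : cont0 (fun r => f (l * r)).
  move=> x; rewrite (_ : (fun r => f (l * `|r|)) = (fun r => f `|r|) \o (fun r => l * r)).
    by apply: continuous_comp; [exact: mulrl_continuous|exact: cf].
  by apply/funext => r; rewrite /= normrM (ger0_norm l1).
pose u (p : T3) := (f (enorm p))%:E; pose v (p : T3) := (f (l * enorm p))%:E.
have mU : measurable_fun setT u by exact: measurable_radial.
have mv : measurable_fun setT v by exact: (measurable_radial cfl).
have u0 p : (0 <= u p)%E by rewrite lee_fin f0// enorm_ge0.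
have v0 p : (0 <= v p)%E by rewrite lee_fin f0// mulr_ge0// enorm_ge0.
rewrite /rint (tonelli3 mu mU u0) (tonelli3 mu mv v0).
rewrite (lebesgue_integral_scale l0 (measurable_outer mu mU u0)); last first.
  by move=> x; apply: integral_ge0 => y _; exact: integral_ge0.
have step x : (\int[mu]_y \int[mu]_z u ((l * x)%R, y, z) =
    (l ^+ 2)%:E * \int[mu]_y \int[mu]_z v (x, y, z))%E.
  rewrite (lebesgue_integral_scale l0 (measurable_middle mu mU u0 _)); last first.
    by move=> y; exact: integral_ge0.
  rewrite expr2 EFinM -muleA; congr (_ * _)%E.
  rewrite -ge0_integralZl_EFin//; last 2 first.
  - by move=> y _; exact: integral_ge0.
  - exact: (measurable_middle mu mv v0).
  apply: eq_integral => y _.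
  rewrite (lebesgue_integral_scale l0 (measurable_inner mU _ _))//.
  congr (_ * _)%E; apply: eq_integral => z _; rewrite /u /v.
  by rewrite -enorm_scale.
under eq_integral do rewrite step.
rewrite ge0_integralZl_EFin//.
- by rewrite muleA -EFinM -exprS.
- by move=> x _; apply: integral_ge0 => y _; exact: integral_ge0.
- exact: (measurable_outer mu mv v0).
- by rewrite exprn_ge0.
Qed.

Lemma rint_pos f : cont0 f -> (forall r, 0 <= r -> 0 <= f r) ->
  (forall r, 0 < r -> 0 < f r) -> (0 < rint f)%E.
Proof.
move=> cf f0 f1; rewrite lt0e rint_ge0// andbT; apply/eqP => I0.
have mf := measurable_radial cf.
have : ae_eq nu [set: T3] (fun p => (f (enorm p))%:E) (cst 0%E).
  apply/(ae_eq_integral_abs _ _ mf) => //; rewrite -[RHS]I0.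
  by apply: eq_integral => p _; rewrite gee0_abs// lee_fin f0// enorm_ge0.
move=> [N [mN N0 sN]].
(* A cube of measure 1 that avoids the origin, where [f] may vanish. *)
pose B : set T3 := (`[1, 2] `*` `[1, 2]) `*` `[1, 2].
have mB : measurable B by apply: measurableX => //; exact: measurableX.
have BN : B `<=` N.
  move=> p [[/= p1 _] _]; apply: sN => /= /(_ I) [] fp.
  have : 0 < f (enorm p); last by rewrite fp ltxx.
  apply: f1; rewrite sqrtr_gt0 -addrA ltr_pwDl ?addr_ge0 ?sqr_ge0//.
  by rewrite exprn_gt0//; move: p1; rewrite in_itv/= => /andP[/(lt_le_trans ltr01)].
have B0 : nu B = 0%E := subset_measure0 mB mN BN N0.
have mI : measurable (`[1, 2] : set R1) by [].
have nB : nu B = (mu `[1%R, 2%R] * mu `[1%R, 2%R] * mu `[1%R, 2%R])%E.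
  exact: (cube_measure mu mI).
move: nB; rewrite B0 lebesgue_measure_itv /= lte_fin ltr1n -!EFinB -!EFinM.
by move=> /(congr1 fine) /=; lra.
Qed.

(** Strictness is asked only for r > 0 because the profiles to be compared agree at the origin. *)
Lemma rint_lt f g : cont0 f -> cont0 g -> (forall r, 0 <= r -> 0 <= f r) ->
  (forall r, 0 <= r -> f r <= g r) -> (forall r, 0 < r -> f r < g r) ->
  (rint g < +oo)%E -> (rint f < rint g)%E.
Proof.
move=> cf cg f0 fg0 fg Ig.
have If : rint f \is a fin_num.
  rewrite ge0_fin_numE ?rint_ge0//; apply: le_lt_trans Ig; exact: rint_le.
have ch : cont0 (fun r => g r - f r) by cont.
have -> : rint g = (rint f + rint (fun r => g r - f r)%R)%E.
  rewrite /rint -ge0_integralD//.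
  - by apply: eq_integral => p _; rewrite -EFinD addrC subrK.
  - by move=> p _; rewrite lee_fin f0// enorm_ge0.
  - exact: measurable_radial.
  - by move=> p _; rewrite lee_fin subr_ge0 fg0// enorm_ge0.
  - exact: (measurable_radial ch).
rewrite lteDl//; apply: rint_pos => // r r0; rewrite ?subr_ge0 ?subr_gt0; auto.
Qed.

Lemma integral_oneDsqrV :
  (\int[mu]_x ((1 + x ^+ 2)^-1)%:E < +oo)%E.
Proof.
rewrite (ge0_symfun_integralT (f := fun x : R => (1 + x ^+ 2)^-1)).
- rewrite (_ : [set x | 0 <= x] = `[0, +oo[); last first.
    by apply/seteqP; split=> x /=; rewrite in_itv/= andbT.
  by have := integral0y_oneDsqr R; rewrite /oneDsqr => ->; rewrite -EFinM ltry.
- by move=> x; rewrite invr_ge0 addr_ge0// sqr_ge0.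
- exact: continuous_oneDsqrV.
- by move=> x; rewrite /= sqrrN.
Qed.

(** Since (1 + x^2)(1 + y^2)(1 + z^2) <= (1 + |p|^2)^3, the majorant lies below a product of three
    integrable functions of one variable. *)
Lemma rint_integrable f C : cont0 f ->
  (forall r, 0 <= r -> 0 <= f r <= C * ((1 + r ^+ 2) ^+ 3)^-1) ->
  nu.-integrable [set: T3] (fun p => (f (enorm p))%:E).
Proof.
move=> cf fC; pose k (x : R1) := (1 + x ^+ 2)^-1.
have q0 (x : R1) : 0 < 1 + x ^+ 2 by rewrite ltr_pwDl// sqr_ge0.
have k0 x : 0 <= k x by rewrite invr_ge0 ltW.
have mk : measurable_fun setT k.
  by apply: continuous_measurable_fun; exact: continuous_oneDsqrV.
have mEk : measurable_fun setT (EFin \o k) by exact/measurable_EFinP.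
pose K (p : T3) := ((k p.1.1 * k p.1.2) * k p.2)%:E.
have mK : measurable_fun setT K.
  apply/measurable_EFinP.
  apply: measurable_funM; last exact: (measurableT_comp mk measurable_snd).
  apply: measurable_funM; apply: (measurableT_comp mk).
    exact: (measurableT_comp measurable_fst measurable_fst).
  exact: (measurableT_comp measurable_snd measurable_fst).
have K0 p : (0 <= K p)%E by rewrite lee_fin !mulr_ge0.
pose J := (\int[mu]_x (k x)%:E)%E.
have Joo : (J < +oo)%E by exact: integral_oneDsqrV.
have J0 : (0 <= J)%E by apply: integral_ge0 => x _; rewrite lee_fin.
have [j j0 JE] : exists2 j : R, 0 <= j & J = j%:E.
  exists (fine J); first exact: fine_ge0.
  by rewrite fineK// ge0_fin_numE.
have IK : (\int[nu]_p K p)%E = (j * j * j)%:E.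
  rewrite (tonelli3 mu mK K0).
  have E1 x y : (\int[mu]_z K (x, y, z))%E = (j * k x * k y)%:E.
    rewrite /K /=; under eq_integral do rewrite EFinM.
    rewrite ge0_integralZl_EFin ?mulr_ge0//; last by move=> z _; rewrite lee_fin.
    by rewrite -/J JE -EFinM; congr EFin; ring.
  have E2 x : (\int[mu]_y \int[mu]_z K (x, y, z))%E = (j * j * k x)%:E.
    under eq_integral do rewrite E1 EFinM.
    rewrite ge0_integralZl_EFin ?mulr_ge0//; last by move=> z _; rewrite lee_fin.
    by rewrite -/J JE -EFinM; congr EFin; ring.
  under eq_integral do rewrite E2 EFinM.
  rewrite ge0_integralZl_EFin ?mulr_ge0//; last by move=> z _; rewrite lee_fin.
  by rewrite -/J JE -EFinM.
have C0 : 0 <= C.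
  have /andP[a b] := fC 0 (lexx _); have := le_trans a b.
  by rewrite expr0n/= addr0 expr1n invr1 mulr1.
have iCK : nu.-integrable [set: T3] (fun p => C%:E * K p)%E.
  apply: integrableZl => //; apply/integrableP; split => //.
  under eq_integral do rewrite gee0_abs//.
  by rewrite IK ltry.
apply: le_integrable iCK => //; first exact: measurable_radial.
move=> [[x y] z] _; have /andP[f0 fle] := fC _ (enorm_ge0 (x, y, z)).
rewrite /K -EFinM !abse_EFin lee_fin !ger0_norm ?mulr_ge0//=.
apply: le_trans fle _; rewrite ler_wpM2l// /k -!invfM.
have qe : 0 < 1 + enorm (x, y, z) ^+ 2 by rewrite ltr_pwDl// sqr_ge0.
rewrite lef_pV2 ?posrE; [|by rewrite exprn_gt0|by rewrite !mulr_gt0].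
rewrite enorm_sqr /= !exprS expr0 !mulr1.
have X0 : 0 <= x * x by rewrite -expr2 sqr_ge0.
have Y0 : 0 <= y * y by rewrite -expr2 sqr_ge0.
have Z0 : 0 <= z * z by rewrite -expr2 sqr_ge0.
rewrite [leRHS]mulrA; apply: ler_pM; rewrite ?mulr_ge0 ?addr_ge0//; last by lra.
by apply: ler_pM; rewrite ?addr_ge0//; lra.
Qed.

Lemma rint_lty f : (forall r, 0 <= r -> 0 <= f r) ->
  nu.-integrable [set: T3] (fun p => (f (enorm p))%:E) -> (rint f < +oo)%E.
Proof. by move=> f0 /integrable_lty; apply. Qed.

Lemma rint_continuous (f : R -> R -> R) F :
  (forall t, cont0 (f t)) -> (forall t r, 0 <= r -> 0 <= f t r <= F r) ->
  (forall r, 0 <= r -> continuous (f ^~ r)) ->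
  nu.-integrable [set: T3] (fun p => (F (enorm p))%:E) ->
  continuous (fun t => fine (rint (f t))).
Proof.
move=> cf fF fc iF t.
have ifn s : nu.-integrable [set: T3] (fun p => (f s (enorm p))%:E).
  apply: le_integrable iF => //; first exact: measurable_radial.
  move=> p _; have /andP[a b] := fF s _ (enorm_ge0 p).
  by rewrite !gee0_abs ?lee_fin// (le_trans a).
apply: (@continuity_under_integral R _ T3 nu (fun s p => f s (enorm p)) setT
  measurableT (t - 1) (t + 1) _ _ (fun p => F (enorm p)) iF).
- by move=> s _; exact: ifn.
- by apply: aeW => p _ s _; exact/fc/enorm_ge0.
- move=> s _; apply: aeW => p _; have /andP[a b] := fF s _ (enorm_ge0 p).
  by rewrite ger0_norm.
- by rewrite inE /= in_itv/= ltrBlDr !ltrDl ltr01.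
Qed.

Lemma rint_cvg0 (f : nat -> R -> R) F :
  (forall n, cont0 (f n)) -> (forall n r, 0 <= r -> 0 <= f n r <= F r) ->
  (forall r, 0 < r -> f n r @[n --> \oo] --> 0) ->
  nu.-integrable [set: T3] (fun p => (F (enorm p))%:E) ->
  (rint (f n) @[n --> \oo] --> 0)%E.
Proof.
move=> cf fF fc iF.
have [|||||_ _ +] := @dominated_convergence _ T3 R nu setT measurableT
  (fun n p => (f n (enorm p))%:E) (cst 0%E) (fun p => (F (enorm p))%:E).
- by move=> n; exact: measurable_radial.
- exact: measurable_cst.
(* Pointwise convergence is known only off the origin, which is a null set. *)
- exists ([set 0] `*` [set 0] `*` [set 0]); split.
  + by apply: measurableX => //; exact: measurableX.
  + have m0 : measurable ([set 0] : set R1) by [].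
    have E : nu (([set 0%R] `*` [set 0%R]) `*` [set 0%R]) =
        (mu [set 0%R] * mu [set 0%R] * mu [set 0%R])%E by exact: (cube_measure mu m0).
    by rewrite lebesgue_measure_set1 mule0 in E.
  + move=> p; apply: contra_notP => p0 _ /=.
    apply: cvg_EFin; first by apply: nearW.
    apply: fc; rewrite lt_neqAle enorm_ge0 andbT; apply/eqP => /esym/enorm_eq0 pE.
    by apply: p0; rewrite pE.
- exact: iF.
- apply: aeW => p n _; have /andP[a b] := fF n _ (enorm_ge0 p).
  by rewrite gee0_abs lee_fin.
- by rewrite integral0; apply.
Qed.

End RadialIntegral.

(** * The explicit solutions and the classification *)

Section Bubble.
Variable R : realType.
Implicit Types (r l : R).

Definition cst0 : R := Num.sqrt 15^-1.

Lemma cst0_gt0 : 0 < cst0.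
Proof. by rewrite sqrtr_gt0 invr_gt0. Qed.

Lemma cst0_sqr : 15 * cst0 ^+ 2 = 1.
Proof. by rewrite sqr_sqrtr ?invr_ge0// divff. Qed.

Definition bubble l r : R := (Num.sqrt l)^-1 * Num.sqrt (cst0 + (l * r) ^+ 2).

Lemma bubble_arg_gt0 l r : 0 < cst0 + (l * r) ^+ 2.
Proof. by rewrite ltr_pwDl ?cst0_gt0// sqr_ge0. Qed.

Lemma bubble_gt0 l r : 0 < l -> 0 < bubble l r.
Proof. by move=> l0; rewrite mulr_gt0 ?invr_gt0 ?sqrtr_gt0// bubble_arg_gt0. Qed.

Lemma bubbleE l (x : R3 R) : 0 < l ->
  (Num.sqrt l)^-1 * U0 (scale3 l x) = bubble l (enorm x).
Proof. by move=> l0; rewrite /U0 enorm_scale// ltW. Qed.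

Lemma bubble_inv6 l r : 0 < l ->
  (bubble l r ^+ 6)^-1 = l ^+ 3 * ((cst0 + (l * r) ^+ 2) ^+ 3)^-1.
Proof.
move=> l0; have e (x : R) : 0 <= x -> Num.sqrt x ^+ 6 = x ^+ 3.
  by move=> x0; rewrite (exprM _ 2 3) sqr_sqrtr.
rewrite exprMn exprVn (e l (ltW l0)) e; last exact: ltW (bubble_arg_gt0 l r).
by rewrite invfM invrK.
Qed.

(** With S = sqrt(a + (l r)^2) and T = 1 / S all functions involved except the bubble are
    polynomials in T. The verification uses T' = - l^2 r T^3 and (l r)^2 T^2 = 1 - a T^2. *)
Lemma bubble_rsol l : 0 < l -> exists p h q, rsol (bubble l) p h q.
Proof.
move=> l0; set a : R := cst0; set k : R := (Num.sqrt l)^-1.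
have k0 : 0 < k by rewrite invr_gt0 sqrtr_gt0.
have k2 : k ^+ 2 * l = 1.
  by rewrite exprVn sqr_sqrtr ?ltW// mulVf// gt_eqF.
pose S r : R := Num.sqrt (a + (l * r) ^+ 2); pose T r : R := (S r)^-1.
have S0 r : 0 < S r by rewrite sqrtr_gt0 bubble_arg_gt0.
have S2 r : S r ^+ 2 = a + (l * r) ^+ 2 by rewrite sqr_sqrtr// ltW// bubble_arg_gt0.
have dS r : is_derive r 1 S (r * (l ^+ 2 * T r)).
  have h1 : is_derive r 1 (fun r => a + (l * r) ^+ 2) (2 * l ^+ 2 * r).
    by drve; ring.
  have h2 := @is_derive1_sqrt R _ (bubble_arg_gt0 l r).
  apply: drvE (@drv_comp R Num.sqrt _ r _ _ h2 h1) _.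
  rewrite /T -/(S r); field.
  by rewrite gt_eqF.
have dT r : is_derive r 1 T (r * (- l ^+ 2 * T r ^+ 3)).
  have h := dS r; rewrite /T; drve; first by rewrite gt_eqF.
  by rewrite /T; field; rewrite gt_eqF.
have cS : cont0 S.
  move=> x; apply: (@continuous_comp _ _ _ (fun r => `|r|) S).
    exact: norm_continuous.
  exact: drv_continuous (dS _).
have cT : cont0 T by rewrite /T; cont => r _; rewrite gt_eqF.
have X2 r : (l * r) ^+ 2 * T r ^+ 2 = 1 - a * T r ^+ 2.
  have -> : (l * r) ^+ 2 = S r ^+ 2 - a by rewrite S2 addrC addKr.
  by rewrite /T; field; rewrite gt_eqF.
pose p r := k * l ^+ 2 * T r.
pose h r := k * l ^+ 2 * (2 * T r + a * T r ^+ 3).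
pose q r := - (k * l ^+ 4 * (2 * T r ^+ 3 + 3 * a * T r ^+ 5)).
exists p, h, q; split.
- by move=> r _; exact: bubble_gt0.
- split; rewrite ?/p ?/h /bubble -?/a -?/k -/S; try cont.
  + by move=> r r0; have e := dS r; drve; ring.
  + move=> r r0; have e := dT r; drve.
    have -> : k * l ^+ 2 * (r * (- l ^+ 2 * T r ^+ 3)) + T r * 0 =
      - (k * l ^+ 2 * T r * ((l * r) ^+ 2 * T r ^+ 2)) / r.
      by field; rewrite gt_eqF.
    by rewrite X2; field; rewrite gt_eqF.
- have k7 r : (bubble l r ^+ 7)^-1 = k * l ^+ 4 * T r ^+ 7.
    rewrite /bubble -/a -/k -/(S r) exprMn invfM.
    congr (_ * _); last by rewrite /T exprVn.
    have -> : k * l ^+ 4 = (k ^+ 2 * l) ^+ 4 / k ^+ 7 by field; rewrite gt_eqF.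
    by rewrite k2 expr1n mul1r.
  split; rewrite ?/q ?/h /=; try cont.
  + by move=> r _; rewrite expf_neq0// gt_eqF// bubble_gt0.
  + by rewrite /bubble -/a -/S; cont.
  + by move=> r r0; have e := dT r; drve; ring.
  + move=> r r0; have e := dT r; rewrite k7; drve.
    set t := T r.
    transitivity (k * l ^+ 4 * ((l * r) ^+ 2 * t ^+ 2) * (6 * t ^+ 3 + 15 * a * t ^+ 5) / r).
      by field; rewrite gt_eqF.
    rewrite X2 -/t.
    (* The first two terms make up - 3 q / r, so the last must be - g^-7 / r. This requires 15 a^2 =
       1, the origin of the constant in U_0. *)
    transitivity (k * l ^+ 4 * (6 * t ^+ 3 + 9 * a * t ^+ 5 - 15 * a ^+ 2 * t ^+ 7) / r).
      by field; rewrite gt_eqF.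
    by rewrite cst0_sqr; field; rewrite gt_eqF.
Qed.

Lemma bubble_cont0 l : 0 < l -> cont0 (bubble l).
Proof. by move=> /bubble_rsol[p [h [q [_ []]]]]. Qed.

Lemma inv6_cont0 (g : R -> R) : cont0 g -> (forall r, 0 <= r -> 0 < g r) ->
  cont0 (fun r => (g r ^+ 6)^-1).
Proof. by move=> cg g0; cont => r r0; rewrite expf_neq0// gt_eqF// g0. Qed.

Lemma bubble_linear l r : 0 < l -> 0 <= r ->
  bubble l r <= (Num.sqrt l)^-1 * Num.sqrt cst0 + (Num.sqrt l)^-1 * l * r.
Proof.
move=> l0 r0; rewrite -mulrA -mulrDr ler_wpM2l ?invr_ge0 ?sqrtr_ge0//.
have lr : 0 <= l * r by rewrite mulr_ge0// ltW.
have s0 := sqrtr_ge0 cst0.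
rewrite -[leRHS]ger0_norm ?addr_ge0// -sqrtr_sqr ler_sqrt ?sqr_ge0//.
rewrite sqrrD (sqr_sqrtr (ltW cst0_gt0)).
by rewrite lerD2r lerDl mulrn_wge0// mulr_ge0.
Qed.

End Bubble.

(** * Comparison with the bubbles and the values taken by Lambda *)

Section Classification.
Local Open Scope classical_set_scope.
Variable R : realType.
Implicit Types (g h p q : R -> R) (r l t : R) (u : R3 R -> R).
Local Notation mu := (@lebesgue_measure R).
Local Notation nu := ((mu \x mu) \x mu)%E.

Lemma LambdaE g : Lambda (g \o @enorm R) = rint (fun r => (g r ^+ 6)^-1).
Proof. by []. Qed.

Lemma inv6_ge0 g r : (forall r, 0 <= r -> 0 < g r) -> 0 <= r -> 0 <= (g r ^+ 6)^-1.
Proof. by move=> g0 r0; rewrite invr_ge0 exprn_ge0// ltW// g0. Qed.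

Lemma inv6_le g1 g2 r : 0 < g1 r -> g1 r <= g2 r -> (g2 r ^+ 6)^-1 <= (g1 r ^+ 6)^-1.
Proof.
move=> g10 g12; have g20 := lt_le_trans g10 g12.
by rewrite lef_pV2 ?posrE ?exprn_gt0// lerXn2r ?nnegrE ?(ltW g10) ?(ltW g20).
Qed.

Lemma inv6_lt g1 g2 r : 0 < g1 r -> g1 r < g2 r -> (g2 r ^+ 6)^-1 < (g1 r ^+ 6)^-1.
Proof.
move=> g10 g12; have g20 := lt_trans g10 g12.
by rewrite ltf_pV2 ?posrE ?exprn_gt0// ltrXn2r ?nnegrE ?(ltW g10) ?(ltW g20).
Qed.

Lemma bubble_integrable :
  nu.-integrable setT (fun x => ((bubble 1 (enorm x) ^+ 6)^-1)%:E).
Proof.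
have l1 := @ltr01 R; have a0 := cst0_gt0 R.
have a1 : cst0 R <= 1.
  by rewrite /cst0 -[leRHS]sqrtr1 ler_sqrt// invf_le1// ler1n.
(* From a <= 1 follows a (1 + r^2) <= a + r^2, hence the constant a^-3. *)
apply: (@rint_integrable R (fun r => (bubble 1 r ^+ 6)^-1) ((cst0 R ^+ 3)^-1)).
  by apply: inv6_cont0 => [|r _]; [exact: bubble_cont0|exact: bubble_gt0].
move=> r r0; rewrite inv6_ge0//=; last by move=> s _; exact: bubble_gt0.
rewrite bubble_inv6// expr1n !mul1r -invfM -exprMn.
rewrite lef_pV2 ?posrE ?exprn_gt0 ?mulr_gt0// ?ltr_pwDl ?sqr_ge0//.
rewrite lerXn2r ?nnegrE ?mulr_ge0 ?addr_ge0 ?sqr_ge0 ?(ltW a0)//.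
by rewrite mulrDr mulr1 lerD2l ler_piMl// sqr_ge0.
Qed.

(** The power -6 matches the dimension: scaling the bubble multiplies its -6th power by l^3, which
    the change of variables compensates. *)
Lemma rint_bubble l : 0 < l ->
  rint (fun r => (bubble l r ^+ 6)^-1) = rint (fun r => (bubble 1 r ^+ 6)^-1).
Proof.
move=> l0; have l1 := @ltr01 R.
pose f r := (bubble 1 r ^+ 6)^-1.
have f0 r : 0 <= f r by rewrite invr_ge0 exprn_ge0// ltW// bubble_gt0.
have cf : cont0 f.
  by apply: inv6_cont0 => [|r _]; [exact: bubble_cont0|exact: bubble_gt0].
rewrite -/f (rint_scale l0 cf)//.
have E r : (bubble l r ^+ 6)^-1 = l ^+ 3 * f (l * r).
  by rewrite /f !bubble_inv6// expr1n !mul1r.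
have cfl : cont0 (fun r => f (l * r)).
  rewrite (_ : (fun r => _) = fun r => (l ^+ 3)^-1 * (bubble l r ^+ 6)^-1).
    apply: cont0M; first exact: cont0C.
    by apply: inv6_cont0 => [|r _]; [exact: bubble_cont0|exact: bubble_gt0].
  by apply/funext => r; rewrite E mulKf// expf_neq0// gt_eqF.
rewrite /rint -ge0_integralZl_EFin//.
- by apply: eq_integral => x _; rewrite E EFinM.
- by move=> x _; rewrite lee_fin.
- exact: (measurable_radial cfl).
- by rewrite exprn_ge0// ltW.
Qed.

Lemma Lambda_starE : Lambda_star R = rint (fun r => (bubble 1 r ^+ 6)^-1).
Proof.
rewrite /Lambda_star /Lambda /rint; apply: eq_integral => x _.
by rewrite -bubbleE// sqrtr1 invr1 mul1r /scale3 !mul1r; case: x => [[]].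
Qed.

Lemma rint_bubble_lty l : 0 < l -> (rint (fun r => (bubble l r ^+ 6)^-1)%R < +oo)%E.
Proof.
move=> l0; rewrite rint_bubble//; apply: rint_lty bubble_integrable => r r0.
by apply: inv6_ge0 => // s _; exact: bubble_gt0.
Qed.

Lemma pos_radial_dichotomy u : pos_radial_solution u ->
  (0 < Lambda u)%E /\ ((Lambda u < Lambda_star R)%E \/
  Lambda u = Lambda_star R /\ exists l, 0 < l /\
    forall x, u x = (Num.sqrt l)^-1 * U0 (scale3 l x)).
Proof.
move=> su; have [_ [ru _]] := su; have [p [h [q s]]] := pos_radial_rsol su.
set g := profile u in s; have uE : u = g \o @enorm R := radialE ru.
have [g0 [cg _ _ _ _] _] := s.
split.
  rewrite uE LambdaE; apply: rint_pos; first exact: inv6_cont0.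
  - by move=> r r0; exact: inv6_ge0.
  - by move=> r r0; rewrite invr_gt0 exprn_gt0// g0// ltW.
(* Solves sqrt(cst0 / l) = g 0, the left side being the value of [bubble l] at the origin. *)
pose l := cst0 R / g 0 ^+ 2; have g00 := g0 0 (lexx _).
have l0 : 0 < l by rewrite divr_gt0 ?cst0_gt0// exprn_gt0.
have bl0 : bubble l 0 = g 0.
  rewrite /bubble mulr0 expr0n addr0 /l sqrtrM ?ltW ?cst0_gt0//.
  rewrite sqrtrV ?sqr_ge0// sqrtr_sqr gtr0_norm// invfM invrK mulrC mulrA mulfV ?mul1r//.
  by rewrite gt_eqF// sqrtr_gt0 cst0_gt0.
have b0 r : 0 <= r -> 0 < bubble l r by move=> _; exact: bubble_gt0.
have cb := bubble_cont0 l0.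
have [p1 [h1 [q1 s1]]] := bubble_rsol l0.
rewrite uE LambdaE Lambda_starE -(rint_bubble l0).
have [hh|hh|hh] := ltgtP (h 0) (h1 0).
- exfalso; pose d := (h1 0 - h 0) / 6.
  have d0 : 0 < d by rewrite divr_gt0// subr_gt0.
  pose k := (Num.sqrt l)^-1; pose A := k * Num.sqrt (cst0 R); pose B := k * l.
  have k0 : 0 <= k by rewrite invr_ge0 sqrtr_ge0.
  have A0 : 0 <= A by rewrite mulr_ge0// sqrtr_ge0.
  have B0 : 0 <= B by rewrite mulr_ge0// ltW.
  (* Here d r^2 = (A + B) r + d r, and r >= 1, so the quadratic gap is at least the linear bound A +
     B r. *)
  pose r := (A + B) / d + 1.
  have r1 : 1 <= r by rewrite lerDr divr_ge0 ?addr_ge0// ltW.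
  have r0 : 0 <= r := le_trans ler01 r1.
  have gb : g 0 <= bubble l 0 by rewrite bl0.
  have c1 := comparison s s1 gb hh r0.
  have c2 : bubble l r <= A + B * r := bubble_linear l0 r0.
  have c3 := g0 r r0.
  have c4 : d * r ^+ 2 = (A + B) * r + d * r.
    by rewrite /r; field; rewrite gt_eqF.
  have c5 : (h1 0 - h 0) * r ^+ 2 / 6 = d * r ^+ 2 by rewrite /d; field.
  have c6 : A <= A * r by rewrite ler_peMr.
  have c7 : 0 <= d * r by rewrite mulr_ge0// ltW.
  by move: c1 c2 c3 c4 c5 c6 c7; lra.
- left; have cmp r : 0 <= r -> bubble l r + (h 0 - h1 0) * r ^+ 2 / 6 <= g r.
    have gb : bubble l 0 <= g 0 by rewrite bl0.
    exact: (comparison s1 s gb hh).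
  have le r : 0 <= r -> bubble l r <= g r.
    move=> r0; apply: le_trans (cmp r r0); rewrite lerDl.
    by rewrite divr_ge0// mulr_ge0 ?sqr_ge0// subr_ge0 ltW.
  apply: rint_lt; try exact: inv6_cont0.
  + by move=> r r0; exact: inv6_ge0.
  + by move=> r r0; apply: inv6_le; [exact: b0|exact: le].
  + move=> r r0; apply: inv6_lt; first exact/b0/ltW.
    apply: lt_le_trans (cmp r (ltW r0)); rewrite ltrDl.
    by rewrite divr_gt0// mulr_gt0 ?exprn_gt0// subr_gt0.
  + exact: rint_bubble_lty.
- right; have E r : 0 <= r -> g r = bubble l r.
    exact: (rsol_unique s s1 (esym bl0) hh).
  split; last by exists l; split => // x; rewrite bubbleE// -E// enorm_ge0.
  by apply: eq_integral => x _; rewrite E// enorm_ge0.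
Qed.

(* Solutions with the value of the bubble at the origin and Laplacian larger by
   [`|t|] there. *)
Lemma solution_family : exists gg : R -> R -> R,
  [/\ forall t r, 0 <= r -> bubble 1 r <= gg t r,
      forall r, 0 <= r -> gg 0 r = bubble 1 r,
      forall t r, 0 <= r -> bubble 1 r + `|t| * r ^+ 2 / 6 <= gg t r,
      forall r, 0 <= r -> continuous (gg ^~ r) &
      forall t, cont0 (gg t) /\ pos_radial_solution (gg t \o @enorm R)].
Proof.
have l1 := @ltr01 R; have [P [H [Q s0]]] := bubble_rsol l1.
pose c := Num.sqrt (cst0 R); have c0 : 0 < c by rewrite sqrtr_gt0 cst0_gt0.
have bc r : 0 <= r -> c <= bubble 1 r.
  move=> _; rewrite /bubble sqrtr1 invr1 !mul1r ler_sqrt ?lerDl ?sqr_ge0//.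
  by rewrite -[r]mul1r ltW// bubble_arg_gt0.
(* With |t| as the excess the family is indexed by the whole line, and continuity in [t] is ordinary
   continuity. *)
have ex t : exists g, exists p h q, [/\ rsol g p h q, g 0 = bubble 1 0,
    h 0 = H 0 + `|t| & forall r, 0 <= r -> bubble 1 r <= g r].
  have [|g [p [h [q [a b d e]]]]] := rsol_exists c0 s0 bc (b := H 0 + `|t|).
    by rewrite lerDl.
  by exists g, p, h, q.
have [gg ggP] := choice ex; exists gg.
have grow t r : 0 <= r -> bubble 1 r + `|t| * r ^+ 2 / 6 <= gg t r.
  move=> r0; have [p [h [q [s g0 h0 lb]]]] := ggP t.
  (* [comparison] wants a strict inequality of the Laplacians at the origin. For t = 0 the bound
     supplied by [rsol_exists] suffices. *)
  have [t0|t0] := eqVneq t 0.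
    have -> : `|t| = 0 by rewrite t0 normr0.
    by rewrite !mul0r addr0 lb.
  have := comparison s0 s; rewrite g0 h0 lexx ltrDl normr_gt0 => /(_ isT t0 r r0).
  by rewrite [H 0 + _]addrC addrK.
split => //.
- by move=> t r r0; have [p [h [q [s g0 h0 lb]]]] := ggP t; exact: lb.
- move=> r r0; have [p [h [q [s g0 h0 lb]]]] := ggP 0.
  by apply: rsol_unique s s0 g0 _ _ r0; rewrite h0 normr0 addr0.
- move=> r; rewrite le_eqVlt => /orP[/eqP <-|r0].
    rewrite (_ : gg ^~ 0 = fun=> bubble 1 0); first by move=> t; exact: cvg_cst.
    by apply/funext => t; have [p [h [q []]]] := ggP t.
  pose K := expR ((2 + 7 / c ^+ 8) * r); have K0 : 0 < K by exact: expR_gt0.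
  (* All members stay above [c], so [stability] holds with one constant and makes the family
     Lipschitz in [t] at each fixed r > 0. *)
  have lip t1 t2 : (r * (gg t2 r - gg t1 r)) ^+ 2 <= (t2 - t1) ^+ 2 * K.
    have [p1 [h1 [q1 [s1 g1 e1 lb1]]]] := ggP t1.
    have [p2 [h2 [q2 [s2 g2 e2 lb2]]]] := ggP t2.
    have cb x : 0 <= x <= r -> c <= gg t1 x /\ c <= gg t2 x.
      move=> /andP[x0 _]; split.
        by apply: le_trans (bc x x0) (lb1 x x0).
      by apply: le_trans (bc x x0) (lb2 x x0).
    have := stability c0 s1 s2 cb _ (r := r); rewrite g1 g2 e1 e2 lexx (ltW r0).
    move=> /(_ erefl isT) /le_trans; apply; rewrite (ler_wpM2r (ltW K0))//.
    have -> : H 0 + `|t2| - (H 0 + `|t1|) = `|t2| - `|t1| by ring.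
    rewrite -(real_normK (num_real (_ - `|t1|))) -(real_normK (num_real (t2 - t1))).
    by rewrite lerXn2r ?nnegrE// ler_dist_dist.
  have lip1 t1 t2 : `|gg t2 r - gg t1 r| <= Num.sqrt K / r * `|t2 - t1|.
    have := lip t1 t2; rewrite -ler_sqrt; last first.
      by rewrite mulr_ge0 ?sqr_ge0// ltW.
    rewrite sqrtr_sqr (sqrtrM K (sqr_ge0 (t2 - t1))) sqrtr_sqr normrM (gtr0_norm r0) => H1.
    by rewrite mulrAC ler_pdivlMr// mulrC [leRHS]mulrC.
  move=> t; apply/cvgrPdist_le => e e0.
  set M := Num.sqrt K / r; have M0 : 0 < M by rewrite divr_gt0// sqrtr_gt0.
  exists (e / M) => /=; first by rewrite divr_gt0.
  move=> y /= ty; apply: le_trans (lip1 _ _) _.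
  by rewrite -ler_pdivlMl// mulrC ltW.
- move=> t; have [p [h [q [s _ _ _]]]] := ggP t; split; last exact: rsol_pos_radial s.
  by case: s => _ [].
Qed.

Lemma Lambda_attained (L : \bar R) : (0 < L)%E -> (L <= Lambda_star R)%E ->
  exists u, pos_radial_solution u /\ Lambda u = L.
Proof.
move=> L0 LL; have [gg [gb g0 grow gc gs]] := solution_family.
have l1 := @ltr01 R; have b0 r : 0 < bubble 1 r by exact: bubble_gt0.
pose f t r := (gg t r ^+ 6)^-1; pose F r := (bubble 1 r ^+ 6)^-1.
have ggt0 t r : 0 <= r -> 0 < gg t r by move=> r0; rewrite (lt_le_trans (b0 r))// gb.
have cf t : cont0 (f t) by apply: inv6_cont0; [case: (gs t)|exact: ggt0].
have fF t r : 0 <= r -> 0 <= f t r <= F r.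
  by move=> r0; rewrite inv6_ge0 ?inv6_le ?gb//; exact: ggt0.
have iF := bubble_integrable.
have cI : continuous (fun t => fine (rint (f t))).
  apply: (rint_continuous cf fF) iF => r r0 t; apply: cvgV.
    by rewrite expf_neq0// gt_eqF// ggt0.
  by apply: (@continuous_comp _ _ _ (gg ^~ r) (fun x => x ^+ 6));
    [exact: gc|exact: exprn_continuous].
have lim0 : (rint (f n%:R) @[n --> \oo] --> 0)%E.
  apply: (rint_cvg0 (f := fun n => f n%:R) (F := F)) => // [n r|r r0]; first exact: fF.
  (* Of the six factors of gg^6, five are bounded below by the bubble and one by n r^2 / 6, so gg^6
     grows at least linearly in n. *)
  have c6 : 0 < bubble 1 r ^+ 5 * (r ^+ 2 / 6).
    by rewrite mulr_gt0 ?exprn_gt0 ?divr_gt0 ?exprn_gt0.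
  apply/cvgrPdist_le => e e0; near=> n.
  have n0 : 0 < n%:R :> R by rewrite ltr0n; near: n; exists 1%N.
  have gn := ggt0 n%:R r (ltW r0).
  rewrite sub0r normrN ger0_norm; last by rewrite invr_ge0 exprn_ge0// ltW.
  rewrite invf_ple ?posrE ?exprn_gt0//.
  apply: (@le_trans _ _ (bubble 1 r ^+ 5 * (r ^+ 2 / 6) * n%:R)).
    rewrite mulrC -ler_pdivrMr//; near: n; exact: nbhs_infty_ger.
  rewrite (exprSr (gg n%:R r) 5) -mulrA; apply: ler_pM.
  - by rewrite exprn_ge0// ltW.
  - by rewrite mulr_ge0 ?divr_ge0 ?sqr_ge0// ltW.
  - by apply: lerXn2r; rewrite ?nnegrE ?(ltW (b0 r)) ?(ltW gn)// gb// ltW.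
  - have := grow n%:R r (ltW r0); rewrite normr_nat => H.
    by have := b0 r; move: H; rewrite [n%:R * _]mulrC mulrAC; lra.
have fin t : rint (f t) \is a fin_num.
  rewrite ge0_fin_numE; last by apply: rint_ge0 => r r0; case/andP: (fF t r r0).
  apply: le_lt_trans (rint_bubble_lty l1); apply: rint_le => //.
  - by apply: inv6_cont0 => [|r _]; [exact: bubble_cont0|exact: b0].
  - by move=> r r0; case/andP: (fF t r r0).
  - by move=> r r0; case/andP: (fF t r r0).
have f0E : rint (f 0) = Lambda_star R.
  rewrite Lambda_starE; apply: eq_integral => x _.
  by rewrite /f g0// enorm_ge0.
have Lfin : L \is a fin_num.
  rewrite ge0_fin_numE ?ltW//; apply: le_lt_trans LL _.
  by rewrite Lambda_starE; exact: rint_bubble_lty.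
have [y Ly] : exists y, L = y%:E by exists (fine L); rewrite fineK.
have y0 : 0 < y by rewrite Ly lte_fin in L0.
have [n ny] : exists n : nat, (rint (f n%:R) < y%:E)%E.
  have : \forall n \near \oo, (rint (f n%:R) < y%:E)%E.
    have /fine_cvgP[_ /cvgrPdist_lt /(_ _ y0)] := lim0.
    apply: filterS => n; rewrite sub0r normrN => /ltr_normlW.
    by rewrite -lte_fin fineK.
  by move=> [N _ NP]; exists N; apply: NP => /=.
have [|||t _ tE] := @IVT R (fun t => fine (rint (f t))) 0 n%:R y.
- by [].
- exact: continuous_subspaceT.
- have h1 : fine (rint (f n%:R)) <= y by rewrite -lee_fin fineK// ltW.
  have h2 : y <= fine (rint (f 0)) by rewrite -lee_fin fineK// f0E -Ly.
  by rewrite ge_min le_max h1 h2 orbT.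
exists (gg t \o @enorm R); split; first by case: (gs t).
by rewrite LambdaE -/(f t) Ly -tE fineK.
Unshelve. all: by end_near. Qed.

End Classification.

Theorem theorem1 (R : realType) :
  (forall L : \bar R,
     (exists u : R3 R -> R, pos_radial_solution u /\ Lambda u = L) <->
     (0 < L /\ L <= Lambda_star R)%E) /\
  (forall u : R3 R -> R, pos_radial_solution u -> Lambda u = Lambda_star R ->
     exists l : R, 0 < l /\
       forall x : R3 R, u x = (Num.sqrt l)^-1 * U0 (scale3 l x)).
Proof.
split=> [L|u su E].
  split=> [[u [su <-]]|[L0 LL]]; last exact: Lambda_attained.
  have [u0 [/ltW ule|[uE _]]] := pos_radial_dichotomy su; split => //.
  by rewrite uE.
have [_ [|[_ //]]] := pos_radial_dichotomy su.
by rewrite E ltxx.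
Qed.
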